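(* Let $n$ be a positive integer and $m=\lceil(4n-11)/9\rceil$. For every integer $k$ such that $m-1\le k\le (n-2)/2$, $$E_{\le k}(n)\ge \binom n2-\frac19\sqrt{1-\frac{2k+2}{n}}\,\bigl(5n^2+19n-31\bigr).$$
   Context: All point sets are finite, in the plane, and in general position (no three collinear). For a set $P$ of $n$ points and an integer $0\le k\le n/2-1$, a $k$-edge of $P$ is a line through two points of $P$ leaving exactly $k$ points of $P$ on one side; $E_k(P)$ is the number of $k$-edges of $P$ and $E_{\le k}(P)=\sum_{j=0}^k E_j(P)$. $E_{\le k}(n)$ is the minimum of $E_{\le k}(P)$ over all sets $P$ of $n$ points in general position in the plane; it is considered only for $0\le k\le n/2-1$. *)

(* Defs.v *)
From HB Require Import structures.
From mathcomp Require Import all_boot all_order all_algebra.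
From mathcomp Require Import finmap.
From mathcomp Require Import boolp classical_sets reals.
From mathcomp Require Import ring.

Set Implicit Arguments.
Unset Strict Implicit.
Unset Printing Implicit Defensive.

Import Order.TTheory GRing.Theory Num.Theory.

Local Open Scope ring_scope.
Local Open Scope fset_scope.

Section PointSets.
Variable R : realType.

Notation point := (R * R)%type.

(* Twice the signed area of the triangle p q r: zero iff p, q, r are collinear,
   and for p != q its sign tells on which side of the line pq the point r is. *)
Definition orient (p q r : point) : R :=
  (q.1 - p.1) * (r.2 - p.2) - (q.2 - p.2) * (r.1 - p.1).

(* This is a line only when p != q. *)
Definition line (p q : point) : set point := [set r | orient p q r = 0]%classic.

Definition general_position (P : {fset point}) : Prop :=
  forall p q r, p \in P -> q \in P -> r \in P ->
    p != q -> p != r -> q != r -> ~ line p q r.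

Definition left_side (P : {fset point}) (p q : point) : {fset point} :=
  [fset r in P | 0 < orient p q r].

Definition right_side (P : {fset point}) (p q : point) : {fset point} :=
  [fset r in P | orient p q r < 0].

Definition leaves (P : {fset point}) (k : nat) (p q : point) : bool :=
  (#|` left_side P p q| == k) || (#|` right_side P p q| == k).

(* The elements are lines, as subsets of the plane, so that a line is counted
   once although it comes from both (p, q) and (q, p), and also when it leaves
   k points on each side. *)
Definition k_edges (P : {fset point}) (k : nat) : {fset set point} :=
  [fset line pq.1 pq.2 | pq in
    [fset pq in P `*` P | (pq.1 != pq.2) && leaves P k pq.1 pq.2]].

Definition E (P : {fset point}) (k : nat) : nat := #|` k_edges P k|.

Definition Ele (P : {fset point}) (k : nat) : nat := (\sum_(j < k.+1) E P j)%N.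

Definition Ele_value (n k v : nat) : Prop :=
  exists P : {fset point},
    [/\ #|` P| = n, general_position P & Ele P k = v].

Lemma Ele_value_ex (n k : nat) : exists v, `[< Ele_value n k v >].
Proof.
pose f (i : nat) : point := (i%:R, i%:R ^+ 2).
have f_inj : injective f by move=> i j [/eqP]; rewrite eqr_nat => /eqP.
pose P : {fset point} := [fset x in map f (iota 0 n)].
exists (Ele P k); apply/asboolP; exists P; split => //.
  by rewrite card_fseq undup_id ?size_map ?size_iota // map_inj_uniq ?iota_uniq.
move=> p q r; rewrite !inE.
move=> /mapP[a _ ->] /mapP[b _ ->] /mapP[c _ ->] ab ac bc.
rewrite /line /orient /=.
have -> : (b%:R - a%:R) * (c%:R ^+ 2 - a%:R ^+ 2)
     - (b%:R ^+ 2 - a%:R ^+ 2) * (c%:R - a%:R)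
   = (b%:R - a%:R) * (c%:R - a%:R) * (c%:R - b%:R) :> R by ring.
have sub_neq0 (i j : nat) : f i != f j -> (j%:R - i%:R : R) != 0.
  by rewrite subr_eq0 eqr_nat; apply: contraNneq => ->.
by apply/eqP; rewrite !mulf_neq0 ?sub_neq0.
Qed.

Definition Ele_min (n k : nat) : nat := ex_minn (Ele_value_ex n k).

End PointSets.

(* Main.v *)
Require Import Defs.
From HB Require Import structures.
From mathcomp Require Import all_boot all_order all_algebra.
From mathcomp Require Import finmap.
From mathcomp Require Import boolp classical_sets reals.
From mathcomp Require Import fintype finset ring lra zify.

(** Why the bound holds.  Write [L p q] for the number of points strictly to
    the left of the directed line [p q].  As long as [2 K + 1 <= n], a line
    leaving fewer than [K] points on one side is seen once among the ordered
    pairs with [L p q < K] (the [shallow] pairs), so [Ele P k] is at least the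
    number [S (k + 1)] of shallow pairs; everything is proved for [S].  When
    [n = 2 k + 2] every line is counted and the square root vanishes.

    Everything rests on one continuity argument, [sweep]: while a line rotates
    counterclockwise about a point [q], each other point met by its tail joins
    the left side and each one met by its head leaves it, so the number of
    points on the left moves by unit steps and cannot pass [j] on the way up
    without meeting some [r] with [L r q = j].

    First inequality, [shallow_bound]:
    [6 S K >= 9 K (K + 1) + (3 K - n)^+ ((3 K - n)^+ + 3)], that is, up to the
    remainder of [n] modulo 3, [S K >= 3 C(K+1, 2) + 3 C(K+1-n/3, 2)].  It goes
    by induction from [(n, K)] to [(n - 3, K - 2)].  Choose a hull vertex [a]
    and a hull edge [b c] such that no side of the triangle [a b c] has more
    than [(n - 2) / 2] points beyond it ([balanced_triangle]); then no small
    half-plane contains [a], [b] and [c] ([far_side_small]).  At least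
    [6 K - 3] shallow pairs touch the triangle, since each hull vertex is in
    [2 K] of them.  A pair shallow at level [K - 2] after the removal of the
    triangle was shallow at level [K] before, because at most two vertices join
    its left side.  Finally [sweep] yields at least [3 K - n] pairs having
    exactly [K - 2] remaining points and at most one vertex on the left.  Call
    [q] early around the vertex [v] if at most [K - 2] remaining points are to
    the left of [q v].  A point which is early around two vertices gives such a
    pair, one which is early around all three gives two ([many_exits]), and
    [K - 1] of the [n - 3] remaining points are early around each vertex.

    Second inequality, [deep_bound]: with [w = n - 2 k - 2], the number of
    edges leaving more than [k] points on both sides is at most [w - 1] times
    the larger of [E_k] and [n - 1].  Rotate a direction and call a point
    central when more than [k] points lie on each side of it; there are always
    [w] central points.  Two points spanning such an edge swap while both are
    central.  If both are non-central at some time, charge the edge to the last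
    of their entries into the centre: the other endpoint was central then, and
    the entry and that endpoint determine the edge
    ([latest_entry], [transient_deep_bound]).  Each half turn has [E_k]
    entries, and each is charged by at most [w - 1 - s] points, where [s] is
    the number of points that are always central.  The edges through those [s]
    points number at most [s (n - 1)], and the sum of both is at most
    [(w - 1) max(E_k, n - 1)].

    Conclusion ([shallow_estimate]).  Let [U] be the number of edges not
    counted by [S], and [B = 5 n^2 + 19 n - 31].  The first inequality gives
    [9 U <= B sqrt ((n - 2 K) / n)] for [K = m].  Counting one more
    level [k >= m] preserves a bound of this form: if [E_k >= n - 1] the second
    inequality says that [U] gets multiplied by at most [(w - 1) / w], and
    [(w - 1)^2 (w + 2) <= w^3]; otherwise it says [U <= (w - 1) (n - 1)], which
    is small enough because [w <= (n + 4) / 9]. *)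

Set Implicit Arguments.
Unset Strict Implicit.
Unset Printing Implicit Defensive.

Import Order.TTheory GRing.Theory Num.Theory.

Local Open Scope ring_scope.

(** * Counting in finite types *)

Lemma card_swap (T : finType) (S : {set T * T}) :
  #|[set u : T * T | (u.2, u.1) \in S]| = #|S|.
Proof.
rewrite -[RHS](card_imset _ (f := fun u : T * T => (u.2, u.1))); last first.
  by case=> ? ? [? ?] [-> ->].
apply: eq_card => -[p q]; rewrite inE /=; apply/idP/imsetP.
  by move=> qpS; exists (q, p).
by case=> -[u v] uvS /= [-> ->].
Qed.

Lemma cardsU_disjoint (I : finType) (A B : {set I}) :
  A :&: B = set0 -> (#|A| + #|B|)%N = #|A :|: B|.
Proof. by move=> AB0; rewrite cardsU AB0 cards0 subn0. Qed.

(** The ranks of the elements of a finite strict order are 0, 1, 2, and so on. *)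
Lemma card_low_rank (I : finType) (D : {set I}) (lt : rel I) :
    {in D, irreflexive lt} ->
    {in D & &, forall x y z, lt x y -> lt y z -> lt x z} ->
    {in D &, forall x y, x != y -> lt x y || lt y x} ->
  forall K, (K <= #|D|)%N ->
  #|[set x in D | (#|[set y in D | lt y x]| < K)%N]| = K.
Proof.
move=> lt_irr lt_trans lt_total K leK.
pose rk x := #|[set y in D | lt y x]|.
have rk_mono x y : x \in D -> y \in D -> lt x y -> (rk x < rk y)%N.
  move=> xD yD ltxy; apply: proper_card; apply/properP; split.
    apply/fintype.subsetP => z /setIdP[zD ltzx]; rewrite inE zD /=.
    exact: lt_trans ltzx ltxy.
  by exists x; rewrite !inE xD // lt_irr.
have rk_inj : {in D &, injective rk}.
  move=> x y xD yD erk; apply/eqP; apply: contraT => /(lt_total _ _ xD yD).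
  by case/orP => /rk_mono; rewrite erk ltnn => ->.
have rk_lt x : x \in D -> (rk x < #|D|)%N.
  move=> xD; apply: proper_card; apply/properP; split.
    by apply/fintype.subsetP => z /setIdP[].
  by exists x; rewrite ?inE ?lt_irr ?andbF.
have s_uniq : uniq (map rk (enum D)).
  rewrite map_inj_in_uniq ?enum_uniq // => x y.
  by rewrite !mem_enum; exact: rk_inj.
have sub_s : {subset map rk (enum D) <= iota 0 #|D|}.
  by move=> _ /mapP[x + ->]; rewrite mem_enum mem_iota => /rk_lt.
have [|_ eq_s] := uniq_min_size s_uniq sub_s.
  by rewrite size_map size_iota -cardE.
have /permP/(_ (fun i => i < K)%N) : perm_eq (map rk (enum D)) (iota 0 #|D|).
  by apply: uniq_perm; rewrite ?iota_uniq.
rewrite count_map -(subnKC leK) iotaD count_cat.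
rewrite (eq_in_count (a2 := predT)) => [|i]; last first.
  by rewrite mem_iota add0n => /andP[_ ->].
rewrite (eq_in_count (a2 := pred0) (s := iota (0 + K) _)) => [|i]; last first.
  by rewrite mem_iota add0n [(i < K)%N]ltnNge => /andP[-> _].
rewrite count_predT count_pred0 size_iota addn0 => eqK; rewrite -[RHS]eqK.
rewrite cardE /enum_mem size_filter count_filter; apply: eq_count => x /=.
by rewrite inE andbC.
Qed.

(** Such pairs are determined by their underlying two-element sets. *)
Lemma card_antisym_pairs (T : finType) (A : {set T}) (D : {set T * T}) :
    (forall p q, (p, q) \in D -> [/\ p \in A, q \in A, p != q & (q, p) \notin D]) ->
  (#|D| <= 'C(#|A|, 2))%N.
Proof.
move=> DP; rewrite -cards_draws -(card_in_imset (f := fun pq : T * T => [set pq.1; pq.2])).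
  apply: subset_leq_card; apply/fintype.subsetP => _ /imsetP[[p q] /DP[pA qA pq _] ->].
  by rewrite inE cards2 pq subUset !sub1set pA qA.
move=> [p q] [p' q'] /= pqD pqD' /setP e.
have [pA qA pq Nqp] := DP _ _ pqD; have [_ _ pq' _] := DP _ _ pqD'.
have := e p; have := e q; rewrite !inE !eqxx orbT /= => /esym + /esym.
case/orP=> /eqP eq1; case/orP=> /eqP eq2; subst; rewrite ?eqxx // in pq pq' *.
by rewrite pqD' in Nqp.
Qed.

Lemma sum_pred_card (I : finType) (B : {set I}) (P : pred I) :
  (\sum_(i in B) P i)%N = #|[set i in B | P i]|.
Proof. by rewrite -sum1dep_card big_mkcondr; apply: eq_bigr => i _; case: (P i). Qed.

Lemma card_fibred (I J : finType) (D : {set I}) (V : I -> {set J}) :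
  #|[set u : I * J | (u.1 \in D) && (u.2 \in V u.1)]| = (\sum_(i in D) #|V i|)%N.
Proof.
rewrite -sum1_card (partition_big fst (mem D)) /= => [|u]; last by rewrite inE => /andP[].
apply: eq_bigr => i iD; rewrite sum1dep_card -[RHS](card_imset _ (f := pair i)) => [|? ? []//].
apply: eq_card => -[i' x]; rewrite inE /=; apply/idP/imsetP.
  by case/andP=> + /eqP e; subst i'; rewrite inE /= => /andP[_ xV]; exists x.
by case=> y yV [-> ->]; rewrite inE /= iD yV eqxx.
Qed.

Lemma card_distinct_pairs (T : finType) (S : {set T}) :
  #|[set pq : T * T | [&& pq.1 \in S, pq.2 \in S & pq.1 != pq.2]]| = (#|S| * #|S|.-1)%N.
Proof.
have -> : (#|S| * #|S|.-1 = \sum_(p in S) #|S :\ p|)%N.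
  by rewrite -sum_nat_const; apply: eq_bigr => p pS; rewrite (cardsD1 p S) pS.
rewrite -card_fibred; apply: eq_card => -[p q]; rewrite !inE /=.
by rewrite [q == p]eq_sym [(p != q) && _]andbC.
Qed.


(** A walk starts at height [b + #|H|]; it goes down at the elements of [H] and up
    at those of [L], in the order of [key].  Starting at most at [j] and ending
    above [j], it has an up-step from [j] to [j + 1].  Removing the last step
    either leaves the same situation or shows that this step is the one. *)
Lemma crossing (T : finType) (R : realType) (key : T -> R) (H L : {set T}) (b j : nat) :
    {in H & L, forall x y, key x != key y} -> {in L &, injective key} ->
    (b + #|H| <= j)%N -> (j < b + #|L|)%N ->
  exists2 r, r \in L &
    (b + #|[set x in H | (key r < key x)%R]| + #|[set x in L | (key x < key r)%R]|)%N = j.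
Proof.
have [n] := ubnP (#|H| + #|L|); elim: n H L b => // n IHn H L b.
rewrite ltnS => leN neHL injL leHj ltjL.
have [x0 x0L] : exists x, x \in L.
  by apply/set0Pn; rewrite -card_gt0; lia.
have x0U : x0 \in H :|: L by rewrite inE x0L orbT.
have [x /= xU maxx] := @arg_maxP _ _ _ x0 (mem (H :|: L)) key x0U.
have {}xU : x \in H :|: L by [].
have {}maxx y : y \in H :|: L -> key y <= key x by exact: maxx.
have [xH|xNH] := boolP (x \in H).
  have cH := cardsD1 x H; rewrite xH in cH.
  have [|||||r rL er] := IHn (H :\ x) L b.+1; try lia.
  - by move=> u v /setD1P[_ uH]; exact: neHL.
  - by [].
  exists r => //; rewrite -er (cardsD1 x [set _ in _ | _]) !inE xH /=.
  have -> : key r < key x.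
    by rewrite lt_def neHL //= maxx // inE rL orbT.
  rewrite -!addnA addnCA add1n !addSn; congr (_.+1); congr (_ + (_ + _))%N.
  by apply: eq_card => y; rewrite !inE andbA.
have xL : x \in L by move: xU; rewrite !inE (negPf xNH).
have cL := cardsD1 x L; rewrite xL in cL.
have [lt_j|le_j] := ltnP j (b + #|L :\ x|).
  have [|||||r rL er] := IHn H (L :\ x) b; try lia.
  - by move=> u v uH /setD1P[_]; exact: neHL.
  - by move=> u v /setD1P[_ uL] /setD1P[_ vL]; exact: injL.
  have {rL} [rx rL] := setD1P rL.
  exists r => //; rewrite -er; congr (_ + _)%N; apply: eq_card => y; rewrite !inE.
  case: eqP => //= ->; rewrite xL ltNge maxx //.
  by rewrite inE rL orbT.
exists x => //.
have -> : [set y in H | key x < key y] = set0.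
  apply/setP => y; rewrite !inE; case: (boolP (y \in H)) => //= yH.
  by rewrite ltNge maxx // inE yH.
have -> : [set y in L | key y < key x] = L :\ x.
  apply/setP => y; rewrite !inE; case: (boolP (y \in L)) => [yL|]; rewrite ?andbF ?andbT //=.
  by rewrite lt_neqAle maxx ?inE ?yL ?orbT // andbT (inj_in_eq injL).
rewrite cards0; lia.
Qed.

(** * Rotating a line about a point *)

Section Planar.
Variables (R : realType) (T : finType) (X : T -> R * R).

Definition generic : Prop := forall p q r : T,
  p != q -> p != r -> q != r -> orient (X p) (X q) (X r) != 0.

Definition cross (u v : R * R) : R := u.1 * v.2 - u.2 * v.1.
Definition vec (p q : T) : R * R := ((X q).1 - (X p).1, (X q).2 - (X p).2).
Definition neg (u : R * R) : R * R := (- u.1, - u.2).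

Notation o p q r := (orient (X p) (X q) (X r)).

Definition nleft (A : {set T}) (p q : T) : nat := #|[set x in A | 0 < o p q x]|.

Lemma orient_cross p q r : o p q r = cross (vec p q) (vec p r).
Proof. by []. Qed.

Lemma orient_rev p q r : o q p r = - o p q r.
Proof. rewrite /orient; ring. Qed.

Lemma orient_rot p q r : o q r p = o p q r.
Proof. rewrite /orient; ring. Qed.

Lemma orient_flip p q r : o p r q = - o p q r.
Proof. rewrite /orient; ring. Qed.

Lemma orient_id p q : (o p p q = 0) * (o p q p = 0) * (o q p p = 0).
Proof. by do !split; rewrite /orient; ring. Qed.

Lemma vecvv p : vec p p = (0, 0).
Proof. by rewrite /vec !subrr. Qed.

Lemma vec_rev p q : vec p q = neg (vec q p).
Proof. by rewrite /vec /neg /= !opprB. Qed.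

Lemma cross_negl u v : cross (neg u) v = - cross u v.
Proof. rewrite /cross /neg /=; ring. Qed.

Lemma cross_negr u v : cross u (neg v) = - cross u v.
Proof. rewrite /cross /neg /=; ring. Qed.

Lemma cross_swap u v : cross v u = - cross u v.
Proof. rewrite /cross /=; ring. Qed.

Lemma crossvv u : cross u u = 0.
Proof. rewrite /cross /=; ring. Qed.

(** Cramer's rule in the basis [d0], [d1]. *)
Lemma cross_cramer d0 d1 u v :
  cross d0 d1 * cross u v = cross d0 u * cross d1 v - cross d1 u * cross d0 v.
Proof. rewrite /cross; ring. Qed.

Hypothesis Xgp : generic.

Lemma orient_rot_vec q r x : o r q x = cross (vec r q) (vec q x).
Proof. rewrite /orient /cross /vec /=; ring. Qed.

Section Sweep.
Variables (B : {set T}) (q : T) (d0 d1 : R * R) (j : nat).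
Hypothesis d01 : 0 < cross d0 d1.
Let a x := cross d0 (vec q x).
Let b x := cross d1 (vec q x).

(** In the coordinates [a], [b] the position of [x] with respect to the line [r q]
    is the sign of a determinant, hence for [a x != 0] is decided by comparing
    the slopes [b x / a x] and [b r / a r]: this is why [b / a] is the time at
    which the rotating line meets [x]. *)
Lemma left_sweep r x : (0 < o r q x) = (0 < b r * a x - a r * b x).
Proof.
rewrite orient_rot_vec -(pmulr_rgt0 _ d01) cross_cramer vec_rev !cross_negr -/(a x) -/(b x) -/(a r) -/(b r).
by congr (_ < _); ring.
Qed.

(** The line starts at direction [d0] and rotates counterclockwise about [q].  It
    meets [x] with its head if [0 < a x], when [x] leaves the left side, and with
    its tail if [a x < 0], when [x] joins it.  [Ev] consists of the points met
    before the rotation stops, and [C] of those that are at the left all along. *)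
Lemma sweep (Ev : {set T}) :
    Ev \subset B -> {in Ev, forall x, a x != 0} ->
    (forall x y, x \in Ev -> y \in B -> y \notin Ev -> a y != 0 ->
      b x / a x < b y / a y) ->
    let C := [set x in B | (a x == 0) && (0 < b x) || (0 < a x) && (x \notin Ev)] in
    let H := [set x in Ev | 0 < a x] in
    let L := [set x in Ev | a x < 0] in
    (#|C| + #|H| <= j)%N -> (j < #|C| + #|L|)%N ->
  exists2 r, r \in L & nleft B r q = j.
Proof.
move=> subEv a_neq0 closedEv C H L leHj ltjL.
pose key x := b x / a x.
have key_inj x y : x \in Ev -> y \in Ev -> key x = key y -> x = y.
  move=> xEv yEv; have ax := a_neq0 _ xEv; have ay := a_neq0 _ yEv.
  have notq z : a z != 0 -> q != z.
    by apply: contraNneq => <-; rewrite /a vecvv /cross /= !mulr0 subrr.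
  move=> /eqP; rewrite /key eqr_div // => /eqP eqk.
  apply/eqP; apply: contraT => neqxy.
  have := Xgp (notq _ ax) (notq _ ay) neqxy.
  rewrite -(inj_eq (mulfI (lt0r_neq0 d01))) mulr0 orient_cross cross_cramer.
  by rewrite -/(a x) -/(b x) -/(a y) -/(b y) mulrC -eqk mulrC subrr eqxx.
have [||r rL <-] := crossing (key := key) (H := H) (L := L) _ _ leHj ltjL.
- move=> x y /setIdP[xEv ax] /setIdP[yEv ay]; apply/eqP => /key_inj exy.
  by move: ax ay; rewrite exy //; lra.
- by move=> x y /setIdP[xEv _] /setIdP[yEv _]; apply: key_inj.
exists r => //; have /setIdP[rEv ar] := rL.
have sgn x : a x != 0 -> b r * a x - a r * b x = (- a r * a x) * (key x - key r).
  by move=> ax; rewrite /key; field; rewrite ax lt_eqF.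
rewrite /nleft -addnA cardsU_disjoint; last first.
  by apply/setP => x; rewrite !inE; case: (ltgtP (a x) 0); rewrite ?andbF.
rewrite cardsU_disjoint; last first.
  apply/setP => x; rewrite !inE; case: (ltgtP (a x) 0); rewrite ?andbF ?orbF //=.
  by case: (x \in Ev); rewrite ?andbF.
apply: eq_card => x; rewrite !inE left_sweep.
have [xB|xNB] /= := boolP (x \in B); last first.
  by rewrite (contraNF (subsetP subEv x) xNB).
case: (ltgtP (a x) 0) => ax /=; rewrite ?andbF ?orbF ?andbT /=.
- rewrite sgn ?lt_eqF // nmulr_rgt0 ?subr_lt0; last by nra.
  case: (boolP (x \in Ev)) => //= xNE.
  by apply/negbTE; rewrite -leNgt ltW // closedEv // lt_eqF.
- rewrite sgn ?gt_eqF // pmulr_rgt0 ?subr_gt0; last by nra.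
  case: (boolP (x \in Ev)) => //= xNE.
  by rewrite closedEv // gt_eqF.
by rewrite ax mulr0 sub0r -mulNr pmulr_rgt0 // oppr_gt0.
Qed.

(** The rotation from [d0] to [d1]: the points met strictly in between have [a] and
    [b] of opposite signs.  The first hypothesis counts the left side just after
    [d0], where a point on the line is at the left when it is on the tail. *)
Lemma sweep_between :
    (#|[set x in B | ((0 < a x) || (a x == 0) && (0 < b x))%R]| <= j)%N ->
    (j < #|[set x in B | (0 < b x)%R]|)%N ->
  exists r, [/\ r \in B, a r < 0, 0 < b r & nleft B r q = j].
Proof.
move=> le_j lt_j.
have [|||||r] := @sweep [set x in B | a x * b x < 0].
- by apply/fintype.subsetP => x /setIdP[].
- by move=> x /setIdP[_]; apply: contraTneq => ->; rewrite mul0r ltxx.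
- move=> x y /setIdP[_ xab] yB; rewrite inE yB /= -leNgt => yab ay.
  have ax : a x != 0 by apply: contraTneq xab => ->; rewrite mul0r ltxx.
  have keyE z : a z != 0 -> a z ^+ 2 * (b z / a z) = a z * b z.
    by move=> az; field.
  have sqr_a z : a z != 0 -> 0 < a z ^+ 2 by move=> az; rewrite exprn_even_gt0.
  apply: (@lt_le_trans _ _ 0).
    by rewrite -(pmulr_rlt0 _ (sqr_a _ ax)) keyE.
  by rewrite -(pmulr_rge0 _ (sqr_a _ ay)) keyE.
- rewrite cardsU_disjoint; last first.
    apply/setP => x; rewrite !inE; case: (x \in B) => //=.
    by case: (ltgtP (a x) 0) => _; case: (a x * b x < 0); rewrite ?andbF .
  apply: leq_trans le_j; apply: subset_leq_card; apply/fintype.subsetP => x.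
  rewrite !inE; case: (x \in B) => //=.
  by case: (ltgtP (a x) 0); rewrite ?andbF ?orbT ?orbF //= => ->; rewrite !mul0r ltxx.
- apply: leq_trans lt_j _; rewrite cardsU_disjoint; last first.
    by apply/setP => x; rewrite !inE; case: (ltgtP (a x) 0); rewrite ?andbF //= ?andbT.
  apply: subset_leq_card; apply/fintype.subsetP => x; rewrite !inE.
  case: (x \in B) => //= bx.
  case: (ltgtP (a x) 0) => ax; rewrite ?bx ?andbF ?orbT //= ?andbT.
  + by rewrite nmulr_rlt0 // bx.
  + by rewrite pmulr_rlt0 // -leNgt ltW.
- move=> /setIdP[/setIdP[rB abr] ar] er; exists r; split => //.
  by move: abr; rewrite nmulr_rlt0.
Qed.

Lemma sweep_half_turn :
    (#|[set x in B | ((0 < a x) || (a x == 0) && (0 < b x))%R]| <= j)%N ->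
    (j < #|[set x in B | ((a x < 0) || (a x == 0) && (0 < b x))%R]|)%N ->
  exists2 r, r \in B :\ q & nleft B r q = j.
Proof.
move=> le_j lt_j.
have [|||||r] := @sweep [set x in B | a x != 0].
- by apply/fintype.subsetP => x /setIdP[].
- by move=> x /setIdP[].
- by move=> x y _ yB; rewrite inE yB => /= /negPn ay0 ay; rewrite ay0 in ay.
- rewrite cardsU_disjoint; last first.
    by apply/setP => x; rewrite !inE; case: (ltgtP (a x) 0); rewrite ?andbF ?andbT //=; case: (x \in B).
  apply: leq_trans le_j; apply: subset_leq_card; apply/fintype.subsetP => x.
  rewrite !inE; case: (x \in B) => //=.
  by case: (ltgtP (a x) 0); rewrite ?andbF ?orbT ?orbF.
- apply: leq_trans lt_j _; rewrite cardsU_disjoint; last first.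
    by apply/setP => x; rewrite !inE; case: (ltgtP (a x) 0); rewrite ?andbF //= ?andbT.
  apply: subset_leq_card; apply/fintype.subsetP => x; rewrite !inE.
  by case: (x \in B) => //=; case: (ltgtP (a x) 0); rewrite ?andbF ?orbT ?orbF.
- move=> /setIdP[/setIdP[rB ar0] ar] er; exists r; rewrite // !inE rB andbT.
  by apply: contraNneq ar0 => ->; rewrite /a vecvv /cross /= !mulr0 subrr.
Qed.
End Sweep.
End Planar.

(** * Hull vertices and balanced triangles *)

Section Hull.
Variables (R : realType) (T : finType) (X : T -> R * R).
Hypothesis Xgp : generic X.
Hypothesis Xinj : injective X.
Notation o p q r := (orient (X p) (X q) (X r)).
Notation nleft := (nleft X).
Notation vec := (vec X).

Lemma orient_neqF p q r : p != q -> p != r -> q != r -> (0 < o p q r) = ~~ (0 < o q p r).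
Proof.
by move=> pq pr qr; have := Xgp pq pr qr; rewrite (orient_rev X p q); case: ltrgtP => //; lra.
Qed.

Lemma nleft_sum (A : {set T}) p q : p \in A -> q \in A -> p != q ->
  (nleft A p q + nleft A q p + 2)%N = #|A|.
Proof.
move=> pA qA pq; rewrite (cardsD1 p) pA (cardsD1 q (A :\ p)) !inE qA eq_sym pq /=.
rewrite cardsU_disjoint; last first.
  by apply/setP => x; rewrite !inE (orient_rev X p q); case: ltrgtP => //; rewrite ?andbF //; lra.
rewrite addnC addnA; congr (_ + _)%N; apply: eq_card => x; rewrite !inE.
have [->|xp] := eqVneq x p; first by rewrite !orient_id ltxx !andbF.
have [->|xq] := eqVneq x q; first by rewrite !orient_id ltxx !andbF.
case: (x \in A) => //=; rewrite eq_sym in xp; rewrite eq_sym in xq.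
by have := Xgp pq xp xq; rewrite (orient_rev X p q); case: ltrgtP => //; lra.
Qed.

Definition hull_vertex (A : {set T}) (v : T) : Prop :=
  exists g, forall x, x \in A -> x != v -> 0 < cross g (vec v x).

(** Around a hull vertex all points lie in an open half-plane, where the angular
    order is linear. *)
Lemma hull_trans A v x y z : hull_vertex A v -> x \in A -> y \in A -> z \in A ->
  x != v -> y != v -> z != v ->
  0 < o v x y -> 0 < o v y z -> 0 < o v x z.
Proof.
move=> [g gP] xA yA zA xv yv zv.
have gx := gP _ xA xv; have gy := gP _ yA yv; have gz := gP _ zA zv.
rewrite !orient_cross => xy yz.
rewrite -(pmulr_rgt0 _ gy).
have -> : cross g (vec v y) * cross (vec v x) (vec v z) =
  cross g (vec v x) * cross (vec v y) (vec v z) +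
  cross g (vec v z) * cross (vec v x) (vec v y) by rewrite /cross; ring.
by rewrite addr_gt0 // mulr_gt0.
Qed.

Lemma card_around A (B : {set T}) v K : hull_vertex A v -> B \subset A :\ v ->
  (K <= #|B|)%N ->
  #|[set x in B | (nleft B v x < K)%N]| = K /\ #|[set x in B | (nleft B x v < K)%N]| = K.
Proof.
move=> hv /fintype.subsetP sB leK.
have inA x : x \in B -> x \in A by move/sB => /setD1P[].
have neqv x : x \in B -> x != v by move/sB => /setD1P[].
have gtF x y : x \in B -> y \in B -> x != y -> (0 < o v x y) || (0 < o v y x).
  move=> xB yB xy; have := Xgp (_ : v != x) (_ : v != y) xy.
  rewrite ![v == _]eq_sym !neqv // => /(_ isT isT).
  by rewrite (orient_flip X v x y) oppr_gt0; case: ltrgtP.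
split.
- apply: (@card_low_rank _ B (fun y x => 0 < o v x y)) => //.
  + by move=> x _; rewrite orient_id ltxx.
  + move=> x y z xB yB zB xy yz; apply: (hull_trans hv) yz xy; by rewrite ?inA ?neqv.
  + by move=> x y xB yB xy; rewrite orbC gtF.
- rewrite -[RHS](@card_low_rank _ B (fun y x => 0 < o v y x) _ _ _ K) //.
  + apply: eq_card => x; rewrite !inE; congr (_ && (_ < _)%N).
    by apply: eq_card => y; rewrite !inE (orient_rot X x v y).
  + by move=> x _; rewrite orient_id ltxx.
  + move=> x y z xB yB zB xy yz; apply: (hull_trans hv) xy yz; by rewrite ?inA ?neqv.
Qed.

(** A lexicographic combination of two functionals can be replaced by a single
    one on a finite set; this turns weak support lines into strict ones. *)
Lemma dominate (D : {set T}) (f g : T -> R) :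
    {in D, forall x, 0 <= f x} -> {in D, forall x, f x = 0 -> 0 < g x} ->
  exists M, {in D, forall x, 0 < M * f x + g x}.
Proof.
move=> f_ge0 g_gt0; exists (1 + \sum_(x in D) `|g x| / f x) => x xD.
have := f_ge0 _ xD; rewrite le_eqVlt => /predU1P[fx0|fx].
  by rewrite -fx0 mulr0 add0r g_gt0.
have le_sum : `|g x| / f x <= \sum_(x in D) `|g x| / f x.
  rewrite (bigD1 x) //= lerDl sumr_ge0 // => y /andP[yD _].
  by rewrite divr_ge0 ?f_ge0.
have := ler_wpM2r (ltW fx) le_sum; rewrite divfK ?gt_eqF // => le_g.
have := lerNnormlW (lexx `|g x|); rewrite mulrDl mul1r; lra.
Qed.

Lemma hull_vertex_exists (A : {set T}) : A != set0 -> exists2 a, a \in A & hull_vertex A a.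
Proof.
move=> /set0Pn[x0 x0A].
have [x xA minx] := @arg_minP _ _ _ x0 (mem A) (fun x => (X x).1) x0A.
pose P y := (y \in A) && ((X y).1 == (X x).1).
have Px : P x by rewrite /P eqxx andbT.
have [a /andP[aA /eqP ax] mina] := @arg_minP _ _ _ x P (fun x => (X x).2) Px.
have [|y|M MP] := @dominate (A :\ a) (fun y => (X y).1 - (X a).1) (fun y => (X y).2 - (X a).2).
- by move=> y /setD1P[_ yA]; rewrite subr_ge0 ax minx.
- move=> /setD1P[ya yA] /eqP; rewrite subr_eq0 => /eqP y1.
  rewrite subr_gt0 lt_neqAle mina ?/P ?yA ?y1 ?ax ?eqxx // andbT.
  apply: contra_neq ya => y2; apply: Xinj.
  by rewrite [LHS]surjective_pairing [RHS]surjective_pairing y1 y2.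
exists a => //; exists (1, - M) => y yA ya.
have := MP y; rewrite !inE ya yA => /(_ isT); rewrite /cross /=; lra.
Qed.

(** The line [v c] supports [A] and meets it in [v] and [c] only; a slight rotation
    about [c] makes [c] the only point of contact. *)
Lemma hull_edge_head (A : {set T}) v c : v \in A -> c \in A -> v != c ->
  nleft A c v = 0%N -> hull_vertex A c.
Proof.
move=> vA cA vc /eqP; rewrite cards_eq0 => /eqP edge.
have right0 x : x \in A -> 0 <= o v c x.
  move=> xA; rewrite leNgt; apply/negP => vcx.
  have : x \in [set x in A | 0 < o c v x].
    by rewrite inE xA (orient_rev X v c) oppr_gt0.
  by rewrite edge inE.
pose w := vec c v.
have [|x|M MP] := @dominate (A :\ c) (fun x => o v c x) (fun x => cross (w.2, - w.1) (vec c x)).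
- by move=> x /setD1P[_ xA]; exact: right0.
- move=> /setD1P[xc xA] vcx.
  have [->|xv] := eqVneq x v.
    have : w.1 != 0 \/ w.2 != 0.
      have [w1|] := eqVneq w.1 0; last by left.
      right; apply: contra_neq vc => w2; apply: Xinj.
      rewrite [LHS]surjective_pairing [RHS]surjective_pairing.
      by move: w1 w2; rewrite /w /vec /= => /subr0_eq -> /subr0_eq ->.
    move=> w0; have : 0 < w.1 ^+ 2 + w.2 ^+ 2.
      by case: w0 => w0; [apply: ltr_wpDr | apply: ltr_wpDl];
        rewrite ?sqr_ge0 // exprn_even_gt0.
    by congr (_ < _); rewrite /cross -/w /=; ring.
  by have := Xgp vc; rewrite eq_sym in xv; rewrite eq_sym in xc; move=> /(_ _ xv xc); rewrite vcx eqxx.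
exists (M * (vec v c).1 + w.2, M * (vec v c).2 - w.1) => x xA xc.
have := MP x; rewrite !inE xc xA => /(_ isT); congr (_ < _).
rewrite orient_rot_vec /cross /=; ring.
Qed.

Lemma hull_succ (A : {set T}) v : v \in A -> hull_vertex A v -> (1 < #|A|)%N ->
  exists c, [/\ c \in A, v != c & nleft A c v = 0%N].
Proof.
move=> vA hv ltA.
have cA := cardsD1 v A; rewrite vA in cA.
have [|_ ] := card_around (K := 1) hv (fintype.subxx (A :\ v)); first by lia.
move/eqP; rewrite eqn_leq => /andP[_]; rewrite card_gt0 => /set0Pn[c].
rewrite !inE => /andP[/andP[cv cA']]; rewrite ltnS leqn0 => /eqP e0.
exists c; split; rewrite 1?eq_sym // -e0; apply: eq_card => x; rewrite !inE.
by have [->|//] := eqVneq x v; rewrite orient_id ltxx andbF.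
Qed.

(** From a hull vertex [a], walk along the hull as long as at most [t] points lie
    beyond the chord [a b], where [t] is half of [n - 2] rounded down.  The
    next hull edge [b c] has nothing beyond it, and since the chord [a c] has
    more than [t] points on one side, at most [n - 3 - t] are on the other. *)
Lemma balanced_triangle (A : {set T}) : (2 < #|A|)%N ->
  exists a b c, [/\ [/\ a \in A, b \in A & c \in A],
    [/\ hull_vertex A a, hull_vertex A b & hull_vertex A c],
    0 < o a b c &
    [/\ (2 * nleft A b a + 2 <= #|A|)%N, (2 * nleft A c b + 2 <= #|A|)%N
      & (2 * nleft A a c + 2 <= #|A|)%N]].
Proof.
move=> ltA; have [t [le_t2 ge_t2]] : exists t, (2 * t + 2 <= #|A| /\ #|A| <= 2 * t + 3)%N.
  by exists (#|A|./2.-1); have := odd_double_half #|A|; case: (odd _); lia.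
have [|a aA ha] := @hull_vertex_exists A; first by rewrite -card_gt0; lia.
pose S := [set b in A | [&& a != b, `[< hull_vertex A b >] & (nleft A b a <= t)%N]].
have [b0 [b0A ab0 e0]] := hull_succ aA ha (ltnW ltA).
have b0S : b0 \in S.
  by rewrite inE b0A ab0 e0 /= andbT; apply/asboolP; apply: hull_edge_head e0.
(* The last hull vertex before the chord from a has more than t points beyond
   it. *)
have [b /setIdP[bA /and3P[ab /asboolP hb le_t]] maxb] :=
  @arg_maxnP _ b0 (mem S) (fun b => nleft A b a) b0S.
have [c [cA bc ebc]] := hull_succ bA hb (ltnW ltA).
have hc := hull_edge_head bA cA bc ebc.
have ac : a != c.
  apply/eqP => eac; move: ebc; rewrite -eac => e1.
  have := nleft_sum aA bA ab; rewrite e1.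
  by move: (nleft A b a) le_t => l le_t eA; lia.
have abc : 0 < o a b c.
  have abc0 : 0 < o b c a.
    have ba : b != a by rewrite eq_sym.
    have ca : c != a by rewrite eq_sym.
    rewrite (orient_neqF bc ba ca); apply/negP => cba.
    have : a \in [set x in A | 0 < o c b x] by rewrite inE aA.
    by move/eqP: ebc; rewrite cards_eq0 => /eqP ->; rewrite inE.
  by rewrite -(orient_rot X a b c).
have grow : (nleft A b a < nleft A c a)%N.
  apply: proper_card; apply/properP; split.
    apply/fintype.subsetP => x /setIdP[xA bax]; rewrite inE xA /=.
    have xa : x != a by apply: contraTneq bax => ->; rewrite orient_id ltxx.
    rewrite -(orient_rot X c a x) in abc *.
    rewrite -(orient_rot X b a x) in bax.
    by apply: (hull_trans ha) bax _ => //; rewrite 1?eq_sym //; rewrite -(orient_rot X c a b).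
  exists b; rewrite inE ?bA ?orient_id ?ltxx // (_ : o c a b = o a b c) //.
  by rewrite -(orient_rot X c a b).
have gt_t : (t < nleft A c a)%N.
  rewrite ltnNge; apply/negP => le_t'.
  have : c \in S by rewrite inE cA ac le_t' andbT /=; apply/asboolP.
  by move=> /maxb /=; rewrite leqNgt grow.
exists a, b, c; split => //.
move: (nleft_sum aA cA ac) le_t gt_t; rewrite ebc.
move: (nleft A a c) (nleft A c a) (nleft A b a) => l1 l2 l3 eA le_t gt_t.
by clear - le_t2 ge_t2 eA le_t gt_t; split; lia.
Qed.

End Hull.

(** * Half-planes and balanced triangles *)

Section Base.
Variables (R : realType) (T : finType) (X : T -> R * R).
Hypothesis Xgp : generic X.
Hypothesis Xinj : injective X.
Notation o p q r := (orient (X p) (X q) (X r)).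
Notation nleft := (nleft X).
Notation vec := (vec X).
Notation hull_vertex := (hull_vertex X).

(** Seen from [b], the points [y], [c], [a], [x] come in this angular order, so [c]
    is in the cone spanned by [y] and [x], and being a hull vertex it is beyond
    the segment [x y].  An affine function which is nonnegative at [b] and
    nonpositive at [x] and [y] is then negative at [c], unless it vanishes at
    both [x] and [y]. *)
Lemma no_two_sides (A : {set T}) a b c p q x y :
    a \in A -> b \in A -> c \in A -> x \in A -> y \in A ->
    hull_vertex A b -> hull_vertex A c -> 0 < o a b c ->
    0 <= o p q b -> 0 <= o p q c -> o p q x <= 0 -> o p q y <= 0 ->
    (o p q x < 0) || (o p q y < 0) ->
    o a b x < 0 -> o b c y < 0 -> False.
Proof.
move=> aA bA cA xA yA hb hc abc fb fc fx fy fxy abx bcy.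
have neq u v w : 0 < o u v w -> [/\ v != u, w != u & w != v].
  by move=> uvw; split; apply: contraTneq uvw => ->; rewrite orient_id ltxx.
have bca : 0 < o b c a by rewrite (orient_rot X a b c).
have bax : 0 < o b a x by rewrite (orient_rev X a b) oppr_gt0.
have byc : 0 < o b y c by rewrite (orient_flip X b c) oppr_gt0.
have [[[cb ab ac] [_ xb xa]] [yb _ cy]] := (neq _ _ _ bca, neq _ _ _ bax, neq _ _ _ byc).
have bcx : 0 < o b c x by apply: (hull_trans hb) bca bax.
have byx : 0 < o b y x by apply: (hull_trans hb) byc bcx.
have [_ _ xc] := neq _ _ _ bcx.
have cyx : o c y x < 0.
  have [g gP] := hc.
  have gb := gP _ bA (_ : b != c); rewrite eq_sym cb in gb; have {}gb := gb isT.
  have gx := gP _ xA xc.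
  have gy := gP _ yA (_ : y != c); rewrite eq_sym cy in gy; have {}gy := gy isT.
  rewrite ltNge; apply/negP => cyx.
  have : o c y x * cross g (vec c b) + o b c x * cross g (vec c y)
       + o b y c * cross g (vec c x) = 0.
    by rewrite /orient /cross /vec /=; ring.
  apply/eqP; rewrite gt_eqF // ltr_wpDl ?mulr_gt0 //.
  by rewrite addr_ge0 ?mulr_ge0 // ltW.
have eqf : o b y x * o p q c =
    o c y x * o p q b + o b c x * o p q y + o b y c * o p q x.
  by rewrite /orient /=; ring.
have le0 : 0 <= o b y x * o p q c by rewrite mulr_ge0 // ltW.
have leb : o c y x * o p q b <= 0 by rewrite mulr_le0_ge0 // ltW.
have ley : o b c x * o p q y <= 0 by rewrite pmulr_rle0.
have lex : o b y c * o p q x <= 0 by rewrite pmulr_rle0.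
case/orP: fxy => f0.
  have : o b y c * o p q x < 0 by rewrite pmulr_rlt0.
  by lra.
have : o b c x * o p q y < 0 by rewrite pmulr_rlt0.
by lra.
Qed.

Section Triangle.
Variables (A : {set T}) (a b c p q : T).
Hypotheses (aA : a \in A) (bA : b \in A) (cA : c \in A) (pA : p \in A).
Hypotheses (abc : 0 < o a b c) (pq : p != q) (pa : p != a) (pb : p != b) (pc : p != c).
Hypotheses (fa : (a == q) || (0 < o p q a)) (fb : (b == q) || (0 < o p q b))
  (fc : (c == q) || (0 < o p q c)).

Lemma closed_left v : (v == q) || (0 < o p q v) -> 0 <= o p q v.
Proof. by case/predU1P => [->|/ltW //]; rewrite orient_id. Qed.

(** Otherwise [z] is inside the triangle, and the affine function [o p q] is at [z]
    a positive combination of its values at the vertices, of which at most one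
    is zero and the others are positive. *)
Lemma beyond_some_side z : z \in A -> (z == p) || (o p q z < 0) ->
  [|| o a b z < 0, o b c z < 0 | o c a z < 0].
Proof.
move=> zA zP.
have f_z : o p q z <= 0.
  by case/predU1P: zP => [->|/ltW //]; rewrite orient_id.
have neqz v : p != v -> (v == q) || (0 < o p q v) -> v != z.
  move=> pv fv; apply/eqP => evz; move: zP; rewrite -evz [v == p]eq_sym (negPf pv) /=.
  by rewrite ltNge closed_left.
have [[az bz] cz] := (neqz _ pa fa, neqz _ pb fb, neqz _ pc fc).
have ab : a != b by apply: contraTneq abc => ->; rewrite orient_id ltxx.
have bc : b != c by apply: contraTneq abc => ->; rewrite orient_id ltxx.
have ca : c != a by apply: contraTneq abc => ->; rewrite orient_id ltxx.
have zab := Xgp ab az bz; have zbc := Xgp bc bz cz; have zca := Xgp ca cz az.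
apply: contraT; rewrite !negb_or -!leNgt => /and3P[].
rewrite !le_eqVlt ![0 == _]eq_sym (negPf zab) (negPf zbc) (negPf zca) /= => z1 z2 z3.
have eqf : o a b c * o p q z = o b c z * o p q a + o c a z * o p q b + o a b z * o p q c.
  by rewrite /orient /=; ring.
have le0 : o a b c * o p q z <= 0 by rewrite pmulr_rle0.
have ga : 0 <= o b c z * o p q a by rewrite pmulr_rge0 ?closed_left.
have gb : 0 <= o c a z * o p q b by rewrite pmulr_rge0 ?closed_left.
have gc : 0 <= o a b z * o p q c by rewrite pmulr_rge0 ?closed_left.
have [aq|aq] := eqVneq a q.
  have : 0 < o c a z * o p q b.
    by rewrite pmulr_rgt0 //; move: fb; rewrite -aq eq_sym (negPf ab).
  by lra.
have : 0 < o b c z * o p q a by rewrite pmulr_rgt0 //; move: fa; rewrite (negPf aq).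
by lra.
Qed.

Hypotheses (ha : hull_vertex A a) (hb : hull_vertex A b) (hc : hull_vertex A c).

Lemma beyond_one_side : o a b p < 0 -> (nleft A q p < nleft A b a)%N.
Proof.
move=> abp; apply: proper_card; apply/properP; split; last first.
  exists p; rewrite inE ?pA ?(orient_rev X a b) ?oppr_gt0 //.
  by rewrite !orient_id ltxx.
apply/fintype.subsetP => x /setIdP[xA]; rewrite (orient_rev X p q) oppr_gt0 => fx.
rewrite inE xA (orient_rev X a b) oppr_gt0 /=.
have /or3P[//|bcx|cax] := @beyond_some_side x xA (introT orP (or_intror fx)).
- by case: (@no_two_sides A a b c p q p x); rewrite ?closed_left ?orient_id ?fx ?orbT // ltW.
- case: (@no_two_sides A c a b p q x p); rewrite ?closed_left ?orient_id ?fx ?orbT // ?ltW //.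
  by rewrite -(orient_rot X c a b).
Qed.

End Triangle.

(** The right side of the line [p q], together with [p], is disjoint from the
    triangle; by [no_two_sides] it lies beyond a single side, which bounds its
    size.  Counting [p] as well is what makes the bound strong enough for every
    [K] with [2 K < n]. *)
Lemma far_side_small (A : {set T}) a b c p q :
    a \in A -> b \in A -> c \in A -> p \in A ->
    hull_vertex A a -> hull_vertex A b -> hull_vertex A c ->
    0 < o a b c -> p != q -> p \notin [:: a; b; c] ->
    (forall v, v \in [:: a; b; c] -> (v == q) || (0 < o p q v)) ->
    (2 * nleft A b a + 2 <= #|A|)%N -> (2 * nleft A c b + 2 <= #|A|)%N ->
    (2 * nleft A a c + 2 <= #|A|)%N ->
  (2 * nleft A q p + 4 <= #|A|)%N.
Proof.
move=> aA bA cA pA ha hb hc abc pq; rewrite !inE !negb_or => /and3P[pa pb pc] fv n1 n2 n3.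
have fa := fv a (mem_head _ _); have fb : (b == q) || (0 < o p q b) by apply: fv; rewrite !inE eqxx orbT.
have fc : (c == q) || (0 < o p q c) by apply: fv; rewrite !inE eqxx !orbT.
have bca : 0 < o b c a by rewrite (orient_rot X a b c).
have cab : 0 < o c a b by rewrite (orient_rot X b c a).
have : [|| o a b p < 0, o b c p < 0 | o c a p < 0].
  by apply: (@beyond_some_side A a b c p q) => //; rewrite eqxx.
case/or3P => side.
- have : (nleft A q p < nleft A b a)%N by apply: (@beyond_one_side A a b c p q).
  by clear -n1; lia.
- have : (nleft A q p < nleft A c b)%N by apply: (@beyond_one_side A b c a p q).
  by clear -n2; lia.
- have : (nleft A q p < nleft A a c)%N by apply: (@beyond_one_side A c a b p q).
  by clear -n3; lia.
Qed.
End Base.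

(** * Shallow pairs at hull vertices *)

Section Recursion.
Variables (R : realType) (T : finType) (X : T -> R * R).
Hypothesis Xgp : generic X.
Hypothesis Xinj : injective X.
Notation o p q r := (orient (X p) (X q) (X r)).
Notation nleft := (nleft X).
Notation vec := (vec X).
Notation hull_vertex := (hull_vertex X).

Lemma nleft_remove (A : {set T}) a p q : a \in A ->
  nleft A p q = ((0 < o p q a)%R + nleft (A :\ a) p q)%N.
Proof.
move=> aA; rewrite [LHS](cardsD1 a) inE aA; congr (_ + _)%N.
by apply: eq_card => x; rewrite !inE andbA.
Qed.

Lemma nleft_self (A : {set T}) p q :
  (nleft (A :\ q) p q = nleft A p q) * (nleft (A :\ p) p q = nleft A p q).
Proof.
split; apply: eq_card => x; rewrite !inE.
  by have [->|//] := eqVneq x q; rewrite orient_id ltxx !andbF.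
by have [->|//] := eqVneq x p; rewrite orient_id ltxx !andbF.
Qed.

(** Ordered pairs: when [2 K < #|A|], at most one orientation of a line has fewer
    than [K] points on its left. *)
Definition shallow (A : {set T}) (K : nat) : {set T * T} :=
  [set pq | [&& pq.1 \in A, pq.2 \in A, pq.1 != pq.2 & (nleft A pq.1 pq.2 < K)%N]].

(** Let [v] be to the left of [q u].  The line rotating about [q] from direction
    [q v] to direction [u q] has both [u] and [v] on its right, and its left
    side grows from at most [j] to more than [j]. *)
Lemma exit_right_of_two_aux (B : {set T}) q u v j :
    q \in B -> u \notin B -> v \notin B -> 0 < o q u v ->
    (nleft B q v <= j)%N -> (j < nleft B u q)%N ->
  exists r, [/\ r \in B, r != q, nleft B r q = j, 0 < o q r u & 0 < o q r v].
Proof.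
move=> qB uB vB quv le_j lt_j.
have qv : q != v by apply: contraNneq vB => <-.
have d01 : 0 < cross (vec q v) (vec u q).
  by rewrite (vec_rev X u q) cross_negr -cross_swap -orient_cross.
have [||r [rB ar br er]] := sweep_between Xgp (B := B) (q := q) (j := j) d01.
- apply: leq_trans le_j; apply: subset_leq_card; apply/fintype.subsetP => x.
  rewrite !inE => /andP[xB]; rewrite xB -!orient_cross => /orP[//|/andP[/eqP avx]].
  have [->|qx] := eqVneq q x; first by rewrite vecvv /cross /= !mulr0 subrr ltxx.
  have vx : v != x by apply: contraNneq vB => ->.
  by have := Xgp qv qx vx; rewrite avx eqxx.
- apply: leq_trans lt_j _; rewrite leq_eqVlt; apply/orP; left; apply/eqP.
  by apply: eq_card => x; rewrite !inE orient_rot_vec.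
exists r; split => //.
- by apply: contraTneq ar => ->; rewrite vecvv /cross /= !mulr0 subrr ltxx.
- by rewrite (orient_rot X u q r) orient_rot_vec.
- by rewrite (orient_flip X q v) oppr_gt0 orient_cross.
Qed.

Lemma exit_right_of_two (B : {set T}) q u v j :
    q \in B -> u \notin B -> v \notin B -> u != v ->
    (nleft B q u <= j)%N -> (nleft B q v <= j)%N ->
    (j < nleft B u q)%N -> (j < nleft B v q)%N ->
  exists r, [/\ r \in B, r != q, nleft B r q = j, 0 < o q r u & 0 < o q r v].
Proof.
move=> qB uB vB uv lu lv ru rv.
have qu : q != u by apply: contraNneq uB => <-.
have qv : q != v by apply: contraNneq vB => <-.
have := Xgp qu qv uv; rewrite neq_lt => /orP[quv|quv].
  have [|r [? ? ? ? ?]] := exit_right_of_two_aux qB vB uB _ lu rv.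
    by rewrite (orient_flip X q u) oppr_gt0.
  by exists r.
exact: exit_right_of_two_aux quv lv ru.
Qed.

(** Each vertex [v] is the first point of [K] pairs and the second point of [K]
    others, by the angular order around [v]; only the three sides of the
    triangle can be counted twice, each in at most one orientation. *)
Lemma triangle_incidences (A Tr : {set T}) K :
    Tr \subset A -> #|Tr| = 3%N -> (forall v, v \in Tr -> hull_vertex A v) ->
    (2 * K < #|A|)%N ->
  (6 * K <= #|[set pq in shallow A K | (pq.1 \in Tr) || (pq.2 \in Tr)]| + 3)%N.
Proof.
move=> /fintype.subsetP sTr Tr3 hTr ltK.
pose O := [set pq in shallow A K | pq.1 \in Tr].
pose I := [set pq in shallow A K | pq.2 \in Tr].
have around v : v \in Tr -> #|[set x in A :\ v | (nleft A v x < K)%N]| = K /\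
    #|[set x in A :\ v | (nleft A x v < K)%N]| = K.
  move=> vTr; have vA := sTr _ vTr.
  have [|e1 e2] := card_around (K := K) Xgp (hTr _ vTr) (fintype.subxx (A :\ v)).
    by have := cardsD1 v A; rewrite vA; lia.
  by split; [rewrite -[RHS]e1 | rewrite -[RHS]e2]; apply: eq_card => x; rewrite !inE !nleft_self.
have cO : #|O| = (3 * K)%N.
  rewrite -sum1_card (partition_big fst (mem Tr)) /= => [|pq /setIdP[]//].
  rewrite (eq_bigr (fun _ => K)) ?sum_nat_const ?Tr3 // => v vTr.
  rewrite sum1dep_card -[RHS](proj1 (around v vTr)) -[RHS](card_imset _ (f := pair v)) => [|? ? []//].
  apply: eq_card => -[p q]; rewrite !inE /=; apply/idP/imsetP.
    case/andP=> /andP[/and4P[pA qA pq lt] _] /eqP epv; subst p.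
    by exists q => //; rewrite !inE qA lt eq_sym pq.
  case=> x; rewrite !inE => /andP[/andP[xv xA] lt] [-> ->].
  by rewrite (sTr _ vTr) xA eq_sym xv lt vTr eqxx.
have cI : #|I| = (3 * K)%N.
  rewrite -sum1_card (partition_big snd (mem Tr)) /= => [|pq /setIdP[]//].
  rewrite (eq_bigr (fun _ => K)) ?sum_nat_const ?Tr3 // => v vTr.
  rewrite sum1dep_card -[RHS](proj2 (around v vTr)) -[RHS](card_imset _ (f := pair^~ v)) => [|? ? []//].
  apply: eq_card => -[p q]; rewrite !inE /=; apply/idP/imsetP.
    case/andP=> /andP[/and4P[pA qA pq lt] _] /eqP eqv; subst q.
    by exists p => //; rewrite !inE pA lt pq.
  case=> x; rewrite !inE => /andP[/andP[xv xA] lt] [-> ->].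
  by rewrite (sTr _ vTr) xA xv lt vTr eqxx.
have cOI : (#|O :&: I| <= 3)%N.
  rewrite -[3%N]/('C(3, 2))%N -Tr3; apply: card_antisym_pairs => p q.
  rewrite !inE /= => /andP[/andP[/and4P[pA qA pq lt] pT] /andP[_ qT]]; split => //.
  rewrite !negb_and pT qT /= !orbF pA qA eq_sym pq /= orbb.
  have := nleft_sum Xgp pA qA pq; clear -lt ltK; lia.
have <- : #|O :|: I| = #|[set pq in shallow A K | (pq.1 \in Tr) || (pq.2 \in Tr)]|.
  by apply: eq_card => pq; rewrite [in LHS]inE ![in LHS](inE, in_setE) !inE -andb_orr.
by have := cardsUI O I; lia.
Qed.

End Recursion.

(** * Removing a balanced triangle *)

Section Step.
Variables (R : realType) (T : finType) (X : T -> R * R).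
Hypothesis Xgp : generic X.
Hypothesis Xinj : injective X.
Notation o p q r := (orient (X p) (X q) (X r)).
Notation nleft := (nleft X).
Notation vec := (vec X).
Notation hull_vertex := (hull_vertex X).
Notation shallow := (shallow X).

Lemma nleft_sum_out (B : {set T}) q v : q \in B -> v \notin B ->
  (nleft B q v + nleft B v q + 1)%N = #|B|.
Proof.
move=> qB vB; have qv : q != v by apply: contraNneq vB => <-.
have := @nleft_sum _ _ _ Xgp (v |: B) q v; rewrite !inE eqxx qB orbT => /(_ isT isT qv).
rewrite cardsU1 vB -(nleft_self X (v |: B) q v) -(nleft_self X (v |: B) v q).2 setU1K //; lia.
Qed.

Lemma first_in_half_plane q r a b c :
    a != b -> b != c -> a != c -> 0 < o q r a -> 0 < o q r b -> 0 < o q r c ->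
  exists2 u, u \in [:: a; b; c] &
    forall v, v \in [:: a; b; c] -> (v == u) || (0 < o q u v).
Proof.
move=> ab bc ac ra rb rc.
have neq v : 0 < o q r v -> q != v by apply: contraTneq => <-; rewrite orient_id ltxx.
have [[qa qb] qc] := (neq _ ra, neq _ rb, neq _ rc).
have hq : hull_vertex [set a; b; c] q.
  by exists (vec q r) => x; rewrite !inE -orient_cross => /orP[/orP[]|] /eqP ->.
have tr x y z : x \in [set a; b; c] -> y \in [set a; b; c] -> z \in [set a; b; c] ->
    0 < o q x y -> 0 < o q y z -> 0 < o q x z.
  have nq w : w \in [set a; b; c] -> w != q.
    by rewrite [w == q]eq_sym !inE => /orP[/orP[]|] /eqP ->.
  by move=> xS yS zS; apply: (hull_trans hq); rewrite ?nq.
have [aS bS cS] : [/\ a \in [set a; b; c], b \in [set a; b; c] & c \in [set a; b; c]].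
  by rewrite !inE !eqxx !orbT.
have ex u : u \in [:: a; b; c] -> [&& (a == u) || (0 < o q u a),
    (b == u) || (0 < o q u b) & (c == u) || (0 < o q u c)] ->
    exists2 u, u \in [:: a; b; c] &
      forall v, v \in [:: a; b; c] -> (v == u) || (0 < o q u v).
  move=> uS /and3P[ua ub uc]; exists u => // v.
  by rewrite !inE => /or3P[] /eqP ->.
have flip x y : q != x -> q != y -> x != y -> 0 < o q x y \/ 0 < o q y x.
  move=> qx qy xy; have := Xgp qx qy xy; rewrite (orient_flip X q x y) oppr_gt0 neq_lt.
  by case/orP; auto.
case: (flip a b) => // qab.
  case: (flip a c) => // qac.
    by apply: (ex a); rewrite ?inE ?eqxx // qab qac !orbT.
  have qcb := tr _ _ _ cS aS bS qac qab.
  by apply: (ex c); rewrite ?inE ?eqxx ?orbT // qcb qac !orbT.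
case: (flip b c) => // qbc.
  by apply: (ex b); rewrite ?inE ?eqxx ?orbT // qab qbc !orbT.
have qca := tr _ _ _ cS bS aS qbc qab.
by apply: (ex c); rewrite ?inE ?eqxx ?orbT // qca qbc !orbT.
Qed.

Section Remove.
Variables (A : {set T}) (a b c : T) (K : nat).
Hypotheses (aA : a \in A) (bA : b \in A) (cA : c \in A).
Hypotheses (ha : hull_vertex A a) (hb : hull_vertex A b) (hc : hull_vertex A c).
Hypothesis abc : 0 < o a b c.
Hypotheses (nab : (2 * nleft A b a + 2 <= #|A|)%N) (nbc : (2 * nleft A c b + 2 <= #|A|)%N)
  (nca : (2 * nleft A a c + 2 <= #|A|)%N).
Hypotheses (K_ge2 : (2 <= K)%N) (ltKA : (2 * K < #|A|)%N).

Let A' : {set T} := A :\ a :\ b :\ c.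
Let j := (K - 2)%N.

Let ab : b != a. Proof. by apply: contraTneq abc => ->; rewrite orient_id ltxx. Qed.
Let bc : c != b. Proof. by apply: contraTneq abc => ->; rewrite orient_id ltxx. Qed.
Let ac : c != a. Proof. by apply: contraTneq abc => ->; rewrite orient_id ltxx. Qed.

Let cardA' : (#|A'| + 3)%N = #|A|.
Proof.
rewrite (cardsD1 a A) aA (cardsD1 b (A :\ a)) (cardsD1 c (A :\ a :\ b)) !inE ab bc ac bA cA -/A'.
by rewrite /= addnC !addnA.
Qed.

Let nleftA' p q : nleft A p q =
  ((0 < o p q a)%R + (0 < o p q b)%R + (0 < o p q c)%R + nleft A' p q)%N.
Proof.
rewrite (@nleft_remove _ _ X A a) // (@nleft_remove _ _ X (A :\ a) b) ?inE ?ab //.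
by rewrite (@nleft_remove _ _ X (A :\ a :\ b) c) ?inE ?bc ?ac // !addnA.
Qed.

Let subA' p : p \in A' -> p \in A /\ p \notin [:: a; b; c].
Proof. by rewrite !inE !negb_or => /and4P[-> -> -> ->]. Qed.

Let not_all_left p q : p \in A -> q \in A -> p != q -> p \notin [:: a; b; c] ->
    (forall v, v \in [:: a; b; c] -> (v == q) || (0 < o p q v)) ->
  (K < nleft A p q)%N.
Proof.
move=> pA qA pq pT left3.
have := far_side_small Xgp aA bA cA pA ha hb hc abc pq pT left3 nab nbc nca.
have := nleft_sum Xgp pA qA pq; move: ltKA; clear; lia.
Qed.

Let right_two r q :=
  [|| (0 < o q r a) && (0 < o q r b), (0 < o q r b) && (0 < o q r c)
    | (0 < o q r a) && (0 < o q r c)].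

Let ev q := [set r in A' | [&& r != q, nleft A' r q == j & right_two r q]].

(** Two vertices around which [q] is early give, by [exit_right_of_two], an exit
    with both of them on the right.  When [q] is early around all three, two such
    exits can only coincide if the three vertices are all on the right, which
    [far_side_small] excludes. *)
Lemma many_exits q : q \in A' ->
  ((nleft A' q a < K.-1) + (nleft A' q b < K.-1) + (nleft A' q c < K.-1) <= #|ev q| + 1)%N.
Proof.
move=> qA'; have [qA qT] := subA' qA'.
have exit u v : u \in [:: a; b; c] -> v \in [:: a; b; c] -> u != v ->
    (nleft A' q u < K.-1)%N -> (nleft A' q v < K.-1)%N ->
    exists r, [/\ r \in A', r != q, nleft A' r q = j, 0 < o q r u & 0 < o q r v].
  move=> uT vT uv lu lv.
  have nT w : w \in [:: a; b; c] -> w \notin A' by apply: contraL => /subA'[].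
  have := nleft_sum_out qA' (nT _ uT); have := nleft_sum_out qA' (nT _ vT).
  move: cardA' ltKA lu lv => e1 e2 lu lv e3 e4.
  by apply: exit_right_of_two; rewrite ?nT //; move: e1 e2 e3 e4 lu lv K_ge2; rewrite /j; clear; lia.
have [aT [bT cT]] : [/\ a \in [:: a; b; c], b \in [:: a; b; c] & c \in [:: a; b; c]].
  by rewrite !inE !eqxx !orbT.
have ev_gt0 r : r \in ev q -> (0 < #|ev q|)%N by move=> rE; apply/card_gt0P; exists r.
have [la|_] := boolP (nleft A' q a < K.-1)%N; have [lb|_] := boolP (nleft A' q b < K.-1)%N;
  have [lc|_] := boolP (nleft A' q c < K.-1)%N; rewrite ?addn0 ?add0n ?addn1 ?ltnS //.
- have [|r [rA' rq er ra rb]] := exit a b aT bT _ la lb; first by rewrite eq_sym.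
  have [|s [sA' sq es sb sc]] := exit b c bT cT _ lb lc; first by rewrite eq_sym.
  (* If r = s, all of a, b, c are on one side of the line r q; seen from q,
     one of them comes first and the two others are to its left. The closed
     half-plane to the left of q u then contains the triangle, but at most K
     points in its interior. *)
  have [ers|rs] := eqVneq r s; last first.
    have <- : #|[set r; s]| = 2%N by rewrite cards2 rs.
    have rE : r \in ev q by rewrite inE rA' rq er /right_two ra rb eqxx.
    have sE : s \in ev q by rewrite inE sA' sq es /right_two sb sc eqxx orbT.
    by apply: subset_leq_card; rewrite subUset !sub1set rE sE.
  have sa : 0 < o q s a by rewrite -ers.
  have [||||||u uT first] := @first_in_half_plane q s a b c => //; rewrite 1?eq_sym //.
  have uA : u \in A by move: uT; rewrite !inE => /or3P[] /eqP ->.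
  have qu : q != u by apply: contraNneq qT => ->.
  have := not_all_left qA uA qu qT first.
  have lu : (nleft A' q u < K.-1)%N by move: uT; rewrite !inE => /or3P[] /eqP ->.
  have : ((0 < o q u a)%R + (0 < o q u b)%R + (0 < o q u c)%R <= 2)%N.
    by move: uT; rewrite !inE => /or3P[] /eqP ->; rewrite orient_id ltxx;
      do 2 case: (0 < _).
  by rewrite (nleftA' q u); move: lu K_ge2; clear; lia.
- have [|r [rA' rq er ra rb]] := exit a b aT bT _ la lb; first by rewrite eq_sym.
  by apply: (ev_gt0 r); rewrite inE rA' rq er /right_two ra rb eqxx.
- have [|r [rA' rq er ra rb]] := exit a c aT cT _ la lc; first by rewrite eq_sym.
  by apply: (ev_gt0 r); rewrite inE rA' rq er /right_two ra rb eqxx !orbT.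
- have [|r [rA' rq er ra rb]] := exit b c bT cT _ lb lc; first by rewrite eq_sym.
  by apply: (ev_gt0 r); rewrite inE rA' rq er /right_two ra rb eqxx !orbT.
Qed.

Lemma shallow_remove_triangle :
  (6 * K + #|shallow A' (K - 2)| + (3 * K - #|A|) <= #|shallow A K| + 3)%N.
Proof.
pose Tr := [set a; b; c].
have TrE v : (v \in Tr) = (v \in [:: a; b; c]) by rewrite !inE orbA.
pose D1 := shallow A' (K - 2).
pose D2 := [set rq : T * T | (rq.2 \in A') && (rq.1 \in ev rq.2)].
pose D3 := [set pq in shallow A K | (pq.1 \in Tr) || (pq.2 \in Tr)].
have cD3 : (6 * K <= #|D3| + 3)%N.
  apply: triangle_incidences => //.
  - by rewrite !subUset !sub1set aA bA cA.
  - by rewrite /Tr setUC cardsU1 cards2 !inE negb_or ac bc eq_sym ab.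
  - by move=> v; rewrite !inE => /orP[/orP[]|] /eqP ->.
have cD2 : (3 * K <= #|D2| + #|A|)%N.
  have -> : #|D2| = (\sum_(q in A') #|ev q|)%N.
    rewrite -sum1_card (partition_big snd (mem A')) /= => [|rq]; last by rewrite inE => /andP[].
    apply: eq_bigr => q qA'; rewrite sum1dep_card -[RHS](card_imset _ (f := pair^~ q)) => [|? ? []//].
    apply: eq_card => -[r s]; rewrite inE /=; apply/idP/imsetP.
      by case/andP=> + /eqP esq; subst s; rewrite inE /= => /andP[_ rE]; exists r.
    by case=> x xE [-> ->]; rewrite inE /= qA' xE eqxx.
  have sub v : v \in [:: a; b; c] -> A' \subset A :\ v.
    by move=> vT; apply/fintype.subsetP => x /subA'[xA xT];
      rewrite in_setD1 xA andbT; apply: contraNneq xT => ->.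
  have around v : v \in [:: a; b; c] -> (\sum_(q in A') (nleft A' q v < K.-1))%N = K.-1.
    move=> vT; have hv : hull_vertex A v by move: vT; rewrite !inE => /or3P[] /eqP ->.
    rewrite sum_pred_card; have [|_ //] := card_around (K := K.-1) Xgp hv (sub _ vT).
    by move: cardA' ltKA K_ge2; clear; lia.
  have : (\sum_(q in A') ((nleft A' q a < K.-1) + (nleft A' q b < K.-1) + (nleft A' q c < K.-1))
      <= \sum_(q in A') (#|ev q| + 1))%N by apply: leq_sum => q; exact: many_exits.
  rewrite !big_split /= !around ?inE ?eqxx ?orbT // sum1_card.
  by move: cardA' ltKA K_ge2; clear; lia.
have D1K : D1 \subset shallow A K.
  apply/fintype.subsetP => -[p q]; rewrite !inE /= -!in_setD1 -/A' => /and4P[pA' qA' pq lt].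
  have [pA pT] := subA' pA'; have [qA _] := subA' qA'; rewrite pA qA pq /=.
  rewrite ltnNge; apply/negP => leK.
  have left3 v : v \in [:: a; b; c] -> (v == q) || (0 < o p q v).
    move: leK; rewrite (nleftA' p q) => leK vT; apply/orP; right.
    move: vT leK; rewrite !inE => /or3P[] /eqP ->; case: (0 < _) => //;
      do 2 case: (0 < _); move: lt K_ge2; clear; lia.
  have := not_all_left pA qA pq pT left3; rewrite (nleftA' p q).
  by move: lt K_ge2; clear; do 3 case: (0 < _); lia.
have D2K : D2 \subset shallow A K.
  apply/fintype.subsetP => -[r q]; rewrite inE /= => /andP[qA' /setIdP[rA' /and3P[rq /eqP er two]]].
  have [rA _] := subA' rA'; have [qA _] := subA' qA'; rewrite inE rA qA rq /= nleftA' er.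
  rewrite !(orient_rev X q r) !oppr_gt0 /j; move: two; rewrite /right_two.
  case: (ltgtP (o q r a) 0); case: (ltgtP (o q r b) 0); case: (ltgtP (o q r c) 0) => //= _ _ _ _;
    move: K_ge2; clear; lia.
have D3K : D3 \subset shallow A K by apply/fintype.subsetP => x /setIdP[].
have D12 : D1 :&: D2 = finset.set0.
  apply/setP => -[r q]; rewrite in_setI !inE /=.
  by apply/negP => /andP[/and4P[_ _ _ lt]] /andP[_ /andP[_ /and3P[_ /eqP er _]]]; move: lt; rewrite er ltnn.
have D123 : (D1 :|: D2) :&: D3 = finset.set0.
  apply/setP => -[r q]; rewrite in_setI in_setU in_set0; apply/negP => /andP[D12rq /setIdP[_ /=]].
  have [/subA'[_ rT] /subA'[_ qT]] : r \in A' /\ q \in A'.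
    case/orP: D12rq; first by rewrite inE => /and4P[].
    by rewrite inE => /andP[? /setIdP[]].
  by rewrite !TrE (negPf rT) (negPf qT).
have : (#|D1| + #|D2| + #|D3| <= #|shallow A K|)%N.
  rewrite (cardsU_disjoint D12) (cardsU_disjoint D123); apply: subset_leq_card.
  by rewrite !subUset D1K D2K.
by rewrite -/D1; move: cD2 cD3; clear; lia.
Qed.

End Remove.

(** With [M] the positive part of [3 K - n], the excess [M (M + 3) / 6] drops by
    at most [M] when [M] is replaced by [M - 3], which is what
    [shallow_remove_triangle] provides. *)
Lemma shallow_bound K (A : {set T}) : (2 * K < #|A|)%N ->
  (9 * K * K.+1 + (3 * K - #|A|) * (3 * K - #|A| + 3) <= 6 * #|shallow A K|)%N.
Proof.
elim/ltn_ind: K A => -[|[|K]] IH A ltKA; first by rewrite muln0.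
  have [|a [b [c [[aA bA cA] [ha hb hc] abc _]]]] := balanced_triangle Xgp Xinj (A := A); first by lia.
  have [[ab bc] ac] : (b != a /\ c != b) /\ c != a.
    by do !split; apply: contraTneq abc => ->; rewrite orient_id ltxx.
  pose S := [set pq in shallow A 1 | (pq.1 \in [set a; b; c]) || (pq.2 \in [set a; b; c])].
  have leS : (6 * 1 <= #|S| + 3)%N.
    apply: triangle_incidences => //.
    - by rewrite !subUset !sub1set aA bA cA.
    - by rewrite setUC cardsU1 cards2 !inE negb_or ac bc eq_sym ab.
    - by move=> v; rewrite !inE => /orP[/orP[]|] /eqP ->.
  have : (#|S| <= #|shallow A 1|)%N by apply/subset_leq_card/fintype.subsetP => x /setIdP[].
  by move: ltKA; clear - leS; lia.
have [|a [b [c [[aA bA cA] [ha hb hc] abc [n1 n2 n3]]]]] := balanced_triangle Xgp Xinj (A := A); first by lia.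
have := shallow_remove_triangle aA bA cA ha hb hc abc n1 n2 n3 (isT : (1 < K.+2)%N) ltKA.
have [[ab bc] ac] : (b != a /\ c != b) /\ c != a.
  by do !split; apply: contraTneq abc => ->; rewrite orient_id ltxx.
have eA : (#|A :\ a :\ b :\ c| + 3)%N = #|A|.
  rewrite (cardsD1 a A) aA (cardsD1 b (A :\ a)) (cardsD1 c (A :\ a :\ b)) !inE ab bc ac bA cA.
  by rewrite /= addnC !addnA.
have := IH K _ (A :\ a :\ b :\ c); rewrite !subSS subn0 => /(_ (leqnSn _)).
move: eA ltKA; move: #|A :\ a :\ b :\ c| #|A| => n' n eA ltKA IHK.
have {}IHK := IHK ltac:(lia); move: IHK.
move: #|_| #|_| => s s' IHK step.
have [le|lt] := leqP n (3 * K.+2).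
  have e : (3 * K.+2 - n = 3 * K - n' + 3 \/ 3 * K < n')%N by lia.
  nia.
by nia.
Qed.

End Step.

(** * Central edges and permanent points *)

Section Central.
Variables (R : realType) (T : finType) (X : T -> R * R).
Hypothesis Xgp : generic X.
Hypothesis Xinj : injective X.
Notation o p q r := (orient (X p) (X q) (X r)).
Notation vec := (vec X).
Notation L := (nleft X finset.setT).
Variable k : nat.
Let n := #|T|.
Hypothesis k_small : (2 * k + 3 <= n)%N.

Definition perp (u : R * R) : R * R := (- u.2, u.1).

Lemma cross_perp_gt0 u : u != (0, 0) -> 0 < cross u (perp u).
Proof.
move=> u0; rewrite (_ : cross _ _ = u.1 ^+ 2 + u.2 ^+ 2); last by rewrite /cross /perp /=; ring.
have [u1|u1] := eqVneq u.1 0.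
  rewrite u1 expr0n add0r exprn_even_gt0 //=; apply: contra_neq u0.
  by case: u u1 => ? ? /= -> ->.
by rewrite ltr_wpDr ?sqr_ge0 // exprn_even_gt0.
Qed.

Lemma vec_neq0 p q : p != q -> vec p q != (0, 0).
Proof.
apply: contra_neq => -[/subr0_eq e1 /subr0_eq e2]; apply: Xinj.
by rewrite [LHS]surjective_pairing [RHS]surjective_pairing e1 e2.
Qed.

(** The left-to-right order of the points for an observer facing direction [d],
    just after [d] in the counterclockwise rotation: on a line parallel to [d]
    the points further back come first.  This breaks ties between parallel
    lines, so that each direction yields a strict linear order. *)
Definition ahead (d : R * R) (x y : T) : bool :=
  (0 < cross d (vec y x)) || (cross d (vec y x) == 0) && (0 < cross (perp d) (vec y x)).

Lemma ahead_neg d x y : ahead (neg d) x y = ahead d y x.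
Proof.
rewrite /ahead (vec_rev X y x) (_ : perp (neg d) = neg (perp d)) //.
by rewrite !cross_negl !cross_negr !opprK.
Qed.

Lemma ahead_irr d : irreflexive (ahead d).
Proof. by move=> x; rewrite /ahead vecvv /cross /= !mulr0 subrr ltxx andbF. Qed.

Lemma cross_vec d x y : cross d (vec y x) = cross d (X x) - cross d (X y).
Proof. rewrite /cross /=; ring. Qed.

Lemma ahead_trans d : transitive (ahead d).
Proof.
move=> y x z; rewrite /ahead !cross_vec !subr_gt0 !subr_eq0.
case/orP=> [xy|/andP[/eqP -> xy]]; case/orP=> [yz|/andP[/eqP eyz yz]].
- by rewrite (lt_trans yz xy).
- by rewrite -eyz xy.
- by rewrite yz.
by rewrite eyz eqxx (lt_trans yz xy) orbT.
Qed.

Lemma ahead_total d x y : d != (0, 0) -> x != y -> ahead d x y || ahead d y x.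
Proof.
move=> d0 xy; rewrite /ahead (vec_rev X x y) !cross_negr !oppr_gt0 oppr_eq0.
set a := cross d _; set b := cross (perp d) _.
case: (ltgtP a 0) => //= a0; case: (ltgtP b 0) => //= b0.
have dd := lt0r_neq0 (cross_perp_gt0 d0).
have e1 : cross d (perp d) * ((X y).1 - (X x).1) = d.1 * b + d.2 * a.
  by rewrite /a /b /cross /perp /vec /=; ring.
have e2 : cross d (perp d) * ((X y).2 - (X x).2) = d.2 * b - d.1 * a.
  by rewrite /a /b /cross /perp /vec /=; ring.
case/eqP: (vec_neq0 xy); congr (_, _); apply: (mulfI dd); rewrite mulr0.
  by rewrite e1 a0 b0 !mulr0 addr0.
by rewrite e2 a0 b0 !mulr0 subr0.
Qed.

Definition rank (d : R * R) (y : T) : nat := #|[set x | ahead d x y]|.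

Lemma rank_sum d y : d != (0, 0) -> (rank d y + rank (neg d) y + 1)%N = n.
Proof.
move=> d0; rewrite /rank cardsU_disjoint; last first.
  apply/setP => x; rewrite !inE ahead_neg; apply/negP => /andP[xy yx].
  by have := ahead_irr d x; rewrite (ahead_trans xy yx).
rewrite addn1 /n -cardsT [RHS](cardsD1 y) inE add1n; congr (_.+1).
apply: eq_card => x; rewrite !inE andbT ahead_neg.
have [->|xy] := eqVneq x y; first by rewrite !ahead_irr.
by rewrite ahead_total.
Qed.

Lemma card_rank_low d : d != (0, 0) -> (#|[set y | (rank d y < k.+1)%N]|) = k.+1.
Proof.
move=> d0; rewrite -[RHS](@card_low_rank T finset.setT (ahead d)).
- by apply: eq_card => y; rewrite !inE; congr (_ < _)%N; apply: eq_card => x; rewrite !inE.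
- by move=> x _; rewrite ahead_irr.
- by move=> x y z _ _ _; exact: ahead_trans.
- by move=> x y _ _; exact: ahead_total.
- by rewrite cardsT -/n; lia.
Qed.

Definition central (d : R * R) : {set T} := [set y | (k < rank d y)%N && (k < rank (neg d) y)%N].

Lemma neg_neq0 (d : R * R) : d != (0, 0) -> neg d != (0, 0).
Proof.
by apply: contra_neq; case: d => a b [/eqP + /eqP]; rewrite !oppr_eq0 => /eqP -> /eqP ->.
Qed.

Lemma card_central d : d != (0, 0) -> (#|central d| + 2 * k + 2)%N = n.
Proof.
move=> d0; have := card_rank_low d0; have := card_rank_low (neg_neq0 d0).
set S1 := [set y | _]; set S2 := [set y | _] => c1 c2.
have S12 : S1 :&: S2 = finset.set0.
  apply/setP => y; rewrite !inE; apply/negP => /andP[]; have := rank_sum y d0.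
  by move: k_small; clear; lia.
have -> : central d = ~: (S1 :|: S2).
  by apply/setP => y; rewrite !inE negb_or !ltnS -!ltnNge andbC.
have := cardsC (S1 :|: S2); rewrite -(cardsU_disjoint S12) c1 c2 -/n; clear; lia.
Qed.

Lemma centralN d : central (neg d) = central d.
Proof.
apply/setP => y; rewrite !inE andbC; congr (_ && (_ < _)%N).
by congr (_ < _)%N; apply: eq_card => x; rewrite !inE !ahead_neg.
Qed.

(** When the rotating line passes from [r] to [z] with [k] points on its left, [z]
    gets its left neighbour number [k + 1] and enters the centre from the left;
    half a turn later it does so from the right.  So an element of [entries z]
    stands for exactly one entry of [z] in each half turn. *)
Definition entries (z : T) : {set T} := [set r | (r != z) && (L r z == k)].
Definition permanent : {set T} := [set z | entries z == finset.set0].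

(** Over a half turn the left and right sides of [z] are exchanged, so a point with
    at most [k] points on one side has an entry. *)
Lemma rank_permanent (d : R * R) z : d != (0, 0) -> z \in permanent -> (k < rank d z)%N.
Proof.
move=> d0; rewrite inE => /eqP ez; rewrite ltnNge; apply/negP => le_k.
have [||r] := sweep_half_turn Xgp (B := finset.setT) (q := z) (j := k) (cross_perp_gt0 d0).
- by apply: leq_trans le_k; apply: subset_leq_card; apply/fintype.subsetP => x; rewrite !inE.
- have := rank_sum z d0.
  pose S := [set x | cross d (vec z x) < 0].
  pose S0 := [set x | (x != z) && (cross d (vec z x) == 0)].
  have leS0 : (#|S0| <= 1)%N.
    apply/card_le1_eqP => x y; rewrite !inE => /andP[xz /eqP ex] /andP[yz /eqP ey].
    apply/eqP; apply: contraT => xy; rewrite eq_sym in xz; rewrite eq_sym in yz.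
    have := Xgp yz xz xy; rewrite orient_cross.
    have dd := cross_perp_gt0 d0.
    by rewrite -(inj_eq (mulfI (lt0r_neq0 dd))) cross_cramer ex ey mul0r mulr0 subrr mulr0 eqxx.
  have leS : (rank (neg d) z <= #|S| + #|S0|)%N.
    apply: leq_trans (leq_card_setU _ _); apply: subset_leq_card; apply/fintype.subsetP => x.
    rewrite !inE ahead_neg /ahead (vec_rev X x z) !cross_negr oppr_gt0 oppr_eq0.
    case/orP=> [->//|/andP[-> c]]; rewrite andbT; apply/orP; right.
    by apply: contraTneq c => ->; rewrite vecvv /cross /= !mulr0 subrr oppr0 ltxx.
  move=> eqn; apply: (@leq_trans #|S|); first by move: le_k k_small eqn leS leS0; clear; lia.
  by apply: subset_leq_card; apply/fintype.subsetP => x; rewrite !inE => ->.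
- by rewrite !inE => /andP[rz _] er; move/setP/(_ r): ez; rewrite !inE rz er eqxx.
Qed.
Lemma permanent_central (d : R * R) : d != (0, 0) -> permanent \subset central d.
Proof.
move=> d0; apply/fintype.subsetP => z zP; rewrite inE !rank_permanent //.
exact: neg_neq0.
Qed.

Lemma entry_central r y : r \in entries y -> y \in central (vec r y).
Proof.
rewrite inE => /andP[ry /eqP ey]; have v0 := vec_neq0 ry.
have : rank (vec r y) y = k.+1.
  rewrite -ey /rank (cardsD1 r) inE.
  have -> : ahead (vec r y) r y.
    rewrite /ahead (vec_rev X y r) !cross_negr crossvv oppr0 ltxx eqxx /=.
    by rewrite -cross_swap cross_perp_gt0.
  rewrite add1n; congr (_.+1); apply: eq_card => x; rewrite !inE /ahead -orient_rot_vec.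
  have [->|xr] := eqVneq x r; first by rewrite orient_id ltxx.
  have [->|xy] := eqVneq x y.
    by rewrite orient_id ltxx eqxx vecvv /cross /= !mulr0 subrr ltxx.
  rewrite eq_sym in xr; rewrite eq_sym in xy.
  by rewrite (negPf (Xgp ry xr xy)) orbF.
have := rank_sum y v0; rewrite inE; move: k_small; clear; lia.
Qed.

(** If [z] has at most [k] points on its left after [d], the left side has to grow
    past [k] before [d1], which is an entry from the left; an entry from the right
    is one from the left for the opposite directions. *)
Lemma entry_between z (d d1 : R * R) : 0 < cross d d1 -> z \notin central d ->
    (k < #|[set x | (0 < cross d1 (vec z x))%R]|)%N ->
    (k < #|[set x | (cross d1 (vec z x) < 0)%R]|)%N ->
  exists r e, [/\ r \in entries z, e = vec r z \/ e = neg (vec r z),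
     0 < cross d e & 0 < cross e d1].
Proof.
have half (c c1 : R * R) : 0 < cross c c1 -> (rank c z <= k)%N ->
    (k < #|[set x | (0 < cross c1 (vec z x))%R]|)%N ->
    exists r, [/\ r \in entries z, 0 < cross c (vec r z) & 0 < cross (vec r z) c1].
  move=> cc1 le_k lt_k.
  have c0 : c != (0, 0) by apply: contraTneq cc1 => ->; rewrite /cross /= !mul0r subrr ltxx.
  have [||r [_ ar br er]] := sweep_between Xgp (B := finset.setT) (q := z) (j := k) cc1.
  - apply: leq_trans le_k; apply: subset_leq_card; apply/fintype.subsetP => x.
    rewrite !inE /= /ahead => /orP[->//|/andP[/eqP e0 b0]]; rewrite e0 eqxx ltxx /=.
    have := cross_cramer c c1 (perp c) (vec z x); rewrite e0 mulr0 subr0 => e1.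
    by rewrite -(pmulr_rgt0 _ cc1) e1 pmulr_rgt0 // cross_perp_gt0.
  - by apply: leq_trans lt_k _; apply: subset_leq_card; apply/fintype.subsetP => x; rewrite !inE.
  exists r; split.
  - rewrite inE er eqxx andbT; apply: contraTneq ar => ->.
    by rewrite vecvv /cross /= !mulr0 subrr ltxx.
  - by rewrite (vec_rev X r z) cross_negr oppr_gt0.
  - by rewrite (vec_rev X r z) cross_negl -cross_swap.
move=> dd1; rewrite inE negb_and -!leqNgt => /orP[] le_k ltl ltr.
  by have [r [? ? ?]] := half _ _ dd1 le_k ltl; exists r, (vec r z); split; auto.
have [||r [rE dr rd]] := half (neg d) (neg d1) _ le_k.
- by rewrite cross_negl cross_negr opprK.
- apply: leq_trans ltr _; apply: subset_leq_card; apply/fintype.subsetP => x.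
  by rewrite !inE cross_negl oppr_gt0.
exists r, (neg (vec r z)); split; auto.
- by move: dr; rewrite cross_negl cross_negr.
- by move: rd; rewrite cross_negl cross_negr.
Qed.

Definition deep : {set T * T} :=
  [set pq | [&& pq.1 != pq.2, (k < L pq.1 pq.2)%N & (k < L pq.2 pq.1)%N]].
(** The pair [(z, r)] stands for the directed edge from [r] to [z], with its
    entering endpoint first. *)
Definition level : {set T * T} := [set e | e.2 \in entries e.1].

Let dot (u v : R * R) : R := u.1 * v.1 + u.2 * v.2.

(** Consider the latest entry of [p] or [q] in the half turn before direction
    [vec p q].  If the other point [z] were not central after it, then, being
    central when [p] and [q] swap, [z] would enter later still. *)
Lemma latest_entry p q : (p, q) \in deep -> p \notin permanent -> q \notin permanent ->
  exists y r z d, [/\ r \in entries y, z \in central d, (d = vec r y \/ d = neg (vec r y)),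
    0 < cross d (vec p q) & (y = p /\ z = q) \/ (y = q /\ z = p)].
Proof.
rewrite inE => /= /and3P[pq lpq lqp] pN qN.
pose d1 := vec p q.
have d10 : d1 != (0, 0) by apply: vec_neq0.
pose key (yr : T * T) := dot (vec yr.2 yr.1) d1 / cross (vec yr.2 yr.1) d1.
pose P (yr : T * T) := ((yr.1 == p) || (yr.1 == q)) && (yr.2 \in entries yr.1).
have [r0 r0P] : exists r, r \in entries p.
  by apply/set0Pn; move: pN; rewrite inE.
have P0 : P (p, r0) by rewrite /P eqxx.
have [[y r] /andP[/= ypq rE] maxy] := @arg_maxP _ _ _ (p, r0) P key P0.
have crossN0 y' r' : P (y', r') -> cross (vec r' y') d1 != 0.
  rewrite /P /= inE => /andP[ypq' /andP[ry /eqP er]].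
  have rp : r' != p.
    apply/eqP => erp; case/orP: ypq' ry er => /eqP -> ry er.
      by rewrite erp eqxx in ry.
    by move: lpq; rewrite -erp er ltnn.
  have rq : r' != q.
    apply/eqP => erq; case/orP: ypq' ry er => /eqP -> ry er.
      by move: lqp; rewrite -erq er ltnn.
    by rewrite erq eqxx in ry.
  case/orP: ypq' => /eqP ->.
    by rewrite -orient_rot_vec Xgp // eq_sym.
  rewrite /d1.
  by rewrite (_ : cross _ _ = o r' p q) ?Xgp // /orient /cross /vec /=; ring.
have Pyr : P (y, r) by rewrite /P /= ypq rE.
(* The denominator in key does not vanish: an entry parallel to the edge would
   give a collinear triple or make the edge itself shallow. *)
have c0 := crossN0 _ _ Pyr.
pose d := if 0 < cross (vec r y) d1 then vec r y else neg (vec r y).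
have dE : d = vec r y \/ d = neg (vec r y) by rewrite /d; case: ifP; auto.
have dd1 : 0 < cross d d1.
  by rewrite /d; case: ifP => // /negbT; rewrite -leNgt cross_negl oppr_gt0 lt_neqAle c0.
have keyE (y' r' : T) (e : R * R) : e = vec r' y' \/ e = neg (vec r' y') ->
    key (y', r') = dot e d1 / cross e d1.
  case=> -> //; rewrite /key /= cross_negl.
  by rewrite (_ : dot (neg _) _ = - dot (vec r' y') d1) ?invrN ?mulrNN // /dot /neg /=; ring.
pose z := if y == p then q else p.
have zE : (y = p /\ z = q) \/ (y = q /\ z = p).
  by rewrite /z; have [->|yp] := eqVneq y p; [left | right; move: ypq; rewrite (negPf yp) => /eqP].
exists y, r, z, d; split => //; apply: contraT => zN.
have zpq : (z == p) || (z == q) by case: zE => -[_ ->]; rewrite eqxx ?orbT.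
have crossz x : cross d1 (vec z x) = o p q x.
  case/orP: zpq => /eqP ->; first by rewrite orient_cross.
  by rewrite -orient_rot_vec.
have [||r' [e [r'E eE de ed1]]] := entry_between dd1 zN.
- apply: leq_trans lpq _; apply: subset_leq_card; apply/fintype.subsetP => x.
  by rewrite !inE /= crossz.
- apply: leq_trans lqp _; apply: subset_leq_card; apply/fintype.subsetP => x.
  by rewrite !inE /= crossz (orient_rev X p q) oppr_gt0.
have := maxy (z, r'); rewrite /P /= zpq r'E => /(_ isT).
rewrite (keyE _ _ _ eE) (keyE _ _ _ dE) leNgt ltr_pdivrMr // mulrAC ltr_pdivlMr //.
rewrite -subr_gt0.
(* The direction e comes after d, so its key is larger. *)
have -> : dot e d1 * cross d d1 - dot d d1 * cross e d1 = cross d e * cross d1 (perp d1).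
  by rewrite /dot /cross /perp /=; ring.
by rewrite mulr_gt0 // cross_perp_gt0.
Qed.

Let towards (e : T * T * bool) : R * R :=
  if e.2 then vec e.1.2 e.1.1 else neg (vec e.1.2 e.1.1).
Let others (e : T * T * bool) : {set T} := (central (towards e) :\: permanent) :\ e.1.1.

Lemma card_others e : e.1 \in level -> (#|others e| + #|permanent| + 2 * k + 3)%N = n.
Proof.
case: e => -[y r] b; rewrite inE /= => rE.
have ry : r != y by move: rE; rewrite inE => /andP[].
have yN : y \notin permanent by rewrite inE; apply/set0Pn; exists r.
have t0 : towards (y, r, b) != (0, 0).
  by rewrite /towards; case: b; rewrite ?neg_neq0 ?vec_neq0.
have yC : y \in central (towards (y, r, b)).
  by rewrite /towards; case: b {t0}; rewrite ?centralN entry_central.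
have := card_central t0; have := cardsD1 y (central (towards (y, r, b)) :\: permanent).
rewrite cardsD (setIidPr (permanent_central t0)) inE yN yC /= -/(others (y, r, b)).
have := subset_leq_card (permanent_central t0); clear; lia.
Qed.

(** The edge can be recovered from the entry it is charged to and the other point:
    the pair swaps once in the half turn following the entry, which also
    determines the orientation. *)
Lemma transient_deep_bound :
  (#|[set pq in deep | (pq.1 \notin permanent) && (pq.2 \notin permanent)]|
    <= 2 * #|level| * (n - 2 * k - 3 - #|permanent|))%N.
Proof.
pose D : {set T * T * bool} := [set e | e.1 \in level].
pose W := [set u : T * T * bool * T | (u.1 \in D) && (u.2 \in others u.1)].
pose G (u : T * T * bool * T) :=
  if 0 < cross (towards u.1) (vec u.1.1.1 u.2) then (u.1.1.1, u.2) else (u.2, u.1.1.1).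
have cW : #|W| = (2 * #|level| * (n - 2 * k - 3 - #|permanent|))%N.
  have -> : (2 * #|level|)%N = #|D|.
    have -> : D = setX level [set: bool].
      by apply/setP => -[e b]; rewrite !inE andbT.
    by rewrite cardsX cardsT card_bool mulnC.
  rewrite card_fibred -sum_nat_const; apply: eq_bigr => e; rewrite inE => /card_others.
  by clear; lia.
rewrite -cW; apply: leq_trans (leq_imset_card G W); apply: subset_leq_card.
apply/fintype.subsetP => -[p q]; rewrite inE /= => /andP[pqD /andP[pN qN]].
have [y [r [z [d [rE zC dE dd1 yz]]]]] := latest_entry pqD pN qN.
have pq : p != q by move: pqD; rewrite inE => /and3P[].
have [b db] : exists b, d = towards (y, r, b).
  by case: dE => ->; [exists true | exists false].
apply/imsetP; exists (y, r, b, z).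
  rewrite inE /=; apply/andP; split; first by rewrite inE /= inE.
  rewrite in_setD1 in_setD -db zC andbT /=.
  by case: yz => -[-> ->]; rewrite ?pN ?qN ?pq // eq_sym pq.
rewrite /G /= -db; case: yz => -[-> ->]; first by rewrite dd1.
by rewrite (vec_rev X q p) cross_negr oppr_gt0 ltNge ltW.
Qed.

Lemma permanent_few : (#|permanent| + 2 * k + 3 <= n)%N.
Proof.
have d0 : ((1, 0) : R * R) != (0, 0) by apply/eqP => -[] /eqP; rewrite oner_eq0.
have [y yN] : exists y, y \notin central (1, 0).
  apply/existsP; rewrite -negb_forall; apply/negP => /forallP all_c.
  have := card_central d0; rewrite (_ : central (1, 0) = finset.setT) ?cardsT -/n; last first.
    by apply/setP => y; rewrite all_c inE.
  by clear; lia.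
have : y \notin permanent by apply: contraNN yN; apply/fintype.subsetP/permanent_central.
rewrite inE => /set0Pn[r rE].
have := @card_others ((y, r), true); rewrite inE rE => /(_ isT) <-.
by clear; lia.
Qed.

Lemma card_deep : (#|deep| + 2 * #|shallow X finset.setT k.+1| = n * n.-1)%N.
Proof.
pose S := shallow X finset.setT k.+1.
pose S' := [set pq | (pq.2, pq.1) \in S].
have cS' : #|S'| = #|S| by exact: card_swap.
have sum p q : p != q -> (L p q + L q p + 2)%N = n.
  by move=> pq; rewrite (nleft_sum Xgp) ?inE // cardsT.
rewrite mul2n -addnn -{2}cS' addnA.
rewrite cardsU_disjoint; last first.
  apply/setP => -[p q]; rewrite !inE /=; case: eqP => //= /eqP /sum.
  by move: (L p q) (L q p) k_small; clear => a b; lia.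
rewrite cardsU_disjoint; last first.
  apply/setP => -[p q]; rewrite !inE /= [q == p]eq_sym; case: eqP => //= /eqP /sum.
  by move: (L p q) (L q p) k_small; clear => a b; lia.
rewrite /n -cardsT -card_distinct_pairs; apply: eq_card => -[p q]; rewrite !inE /=.
rewrite [q == p]eq_sym; case: eqP => //= /eqP /sum.
by move: (L p q) (L q p) k_small; clear => a b; lia.
Qed.

Lemma card_level : (#|level| + #|shallow X finset.setT k| = #|shallow X finset.setT k.+1|)%N.
Proof.
have -> : #|level| = #|[set pq | (pq.1 != pq.2) && (L pq.1 pq.2 == k)]|.
  rewrite -[LHS](card_imset _ (f := fun pq : T * T => (pq.2, pq.1))); last by case=> ? ? [? ?] [-> ->].
  apply: eq_card => -[p q]; rewrite [in RHS]inE /=; apply/imsetP/idP.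
    by case=> -[u v]; rewrite !inE /= => h [-> ->].
  by move=> h; exists (q, p); rewrite // !inE.
rewrite cardsU_disjoint; last first.
  by apply/setP => -[p q]; rewrite !inE /=; case: (p != q) => //=; case: ltngtP.
apply: eq_card => -[p q]; rewrite !inE /= ltnS (leq_eqVlt (L p q) k).
by case: (p != q).
Qed.

(** With [s] permanent points, at most [2 s (n - 1)] ordered pairs contain one of
    them, and the other deep pairs number at most [2 (w - 1 - s) E_k], where
    [w = n - 2 k - 2]. *)
Lemma deep_bound :
  (#|deep| <= 2 * (n - 2 * k - 3) * maxn #|level| n.-1)%N.
Proof.
have few := permanent_few; have tr := transient_deep_bound.
set s := #|permanent| in few tr; set tD := [set _ in _ | _] in tr.
pose Q (S : {set T}) := [set pq : T * T | [&& pq.1 \in S, pq.2 \in S & pq.1 != pq.2]].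
have cS : (#|~: permanent| + s = n)%N by rewrite addnC cardsC.
have sub : Q (~: permanent) \subset Q finset.setT.
  by apply/fintype.subsetP => -[p q]; rewrite !inE /= => /and3P[].
have : (#|deep| <= #|tD| + (n * n.-1 - (n - s) * (n - s).-1))%N.
  have -> : (n * n.-1 - (n - s) * (n - s).-1)%N = #|Q finset.setT :\: Q (~: permanent)|.
    rewrite cardsD (setIidPr sub) !card_distinct_pairs cardsT -/n.
    by have -> : #|~: permanent| = (n - s)%N by move: cS; clear; lia.
  apply: leq_trans (leq_card_setU _ _); apply: subset_leq_card.
  apply/fintype.subsetP => -[p q] pqD; have := pqD; rewrite inE => /= /and3P[pq _ _].
  by rewrite in_setU in_setD [in X in X || _]inE pqD !inE /= pq !andbT /= -negb_or orbN.
move: tr few; move: #|level| #|tD| #|deep| => E x y.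
have : (0 < n)%N by move: k_small; clear; lia.
case: n => // n' _; rewrite /= => tr few.
move: s few tr {cS}; clear => s few tr le_y.
have [w ew] : exists w, (n'.+1 - 2 * k - 3 = w + s)%N by exists (n'.+1 - 2 * k - 3 - s)%N; lia.
have e2 : (n'.+1 * n' - (n'.+1 - s) * (n'.+1 - s).-1 <= 2 * s * n')%N.
  have [t et] : exists t, (n' = t + s)%N by exists (n' - s)%N; lia.
  have -> : (n'.+1 - s = t.+1)%N by lia.
  have ss : (s <= s * s)%N by case: (s) => // u; rewrite leq_pmulr.
  by rewrite et /= leq_subLR; move: ss; clear; lia.
have [h1 h2] : (E <= maxn E n' /\ n' <= maxn E n')%N by rewrite leq_maxl leq_maxr.
move: (maxn E n') h1 h2 => M h1 h2.
have e3 : (x <= 2 * (w * M))%N.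
  apply: leq_trans tr _; rewrite ew addnK -mulnA leq_pmul2l //.
  by rewrite mulnC leq_mul2l h1 orbT.
have e4 : (s * n' <= s * M)%N by rewrite leq_mul2l h2 orbT.
by rewrite ew; move: e2 e3 e4 le_y; clear; lia.
Qed.

End Central.

(** * Edges as lines and as ordered pairs *)

Section Link.
Local Open Scope fset_scope.
Variables (R : realType) (P : {fset R * R}).
Hypothesis Pgp : general_position P.

Let X (p : P) : R * R := val p.

Lemma generic_val : generic X.
Proof.
move=> p q r pq pr qr; apply/eqP => e.
by have := Pgp (valP p) (valP q) (valP r) pq pr qr; apply.
Qed.

Lemma card_fset_filter (Q : pred (R * R)) :
  #|` [fset r in P | Q r]| = #|[set x : P | Q (val x)]|.
Proof.
have /perm_size -> : perm_eq (enum_fset [fset r in P | Q r]) (filter Q (enum_fset P)).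
  apply: uniq_perm; rewrite ?filter_uniq ?fset_uniq // => x.
  by rewrite -[LHS]/(x \in [fset r in P | Q r]) !in_fsetE /= mem_filter andbC.
rewrite enum_fsetE filter_map size_map size_filter -sum1_count -sum1dep_card.
by rewrite big_enum_cond; apply: eq_bigl => x.
Qed.

Lemma leaves_nleft (j : nat) (p q : P) :
  leaves P j (val p) (val q) = (nleft X finset.setT p q == j) || (nleft X finset.setT q p == j).
Proof.
rewrite /leaves /left_side /right_side !card_fset_filter.
have -> : #|[set x : P | 0 < orient (val p) (val q) (val x)]| = nleft X finset.setT p q.
  by apply: eq_card => x; rewrite !inE.
have -> // : #|[set x : P | orient (val p) (val q) (val x) < 0]| = nleft X finset.setT q p.
by apply: eq_card => x; rewrite !inE (orient_rev X p q) oppr_gt0.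
Qed.

Lemma line_inj (p q p' q' : P) : p != q -> p' != q' ->
  line (val p) (val q) = line (val p') (val q') -> (p', q') = (p, q) \/ (p', q') = (q, p).
Proof.
move=> pq pq' e.
have on r : r = p' \/ r = q' -> r = p \/ r = q.
  move=> rpq; have : line (val p) (val q) (val r).
    by rewrite e /line /=; case: rpq => ->; rewrite (orient_id X).
  have [->|rp] := eqVneq r p; first by left.
  have [->|rq] := eqVneq r q; first by right.
  rewrite eq_sym in rp; rewrite eq_sym in rq.
  by move/eqP; rewrite (negPf (generic_val pq rp rq)).
have [ep eq] := (on p' (or_introl erefl), on q' (or_intror erefl)).
case: ep eq pq' => -> [] ->; rewrite ?eqxx; by auto.
Qed.

Lemma E_lower (D : {set P * P}) (j : nat) :
    (forall p q, (p, q) \in D -> [/\ p != q, (q, p) \notin D & leaves P j (val p) (val q)]) ->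
  (#|D| <= E P j)%N.
Proof.
move=> DP; rewrite /E cardE -(size_map (fun u : P * P => line (val u.1) (val u.2))).
apply: uniq_leq_size.
  rewrite map_inj_in_uniq ?enum_uniq // => -[p q] [p' q']; rewrite !mem_enum /= => pqD pqD' e.
  have [pq Nqp _] := DP _ _ pqD; have [pq' _ _] := DP _ _ pqD'.
  by case: (line_inj pq pq' e) => // e'; rewrite e' in pqD'; rewrite pqD' in Nqp.
move=> _ /mapP[[p q] + ->]; rewrite mem_enum /= => /DP[pq _ lv].
apply/imfsetP; exists (val p, val q) => //=.
rewrite !in_fsetE /= inE /= -[_ \in mem_seq _]/((fsval p, fsval q) \in P `*` P).
by rewrite in_fsetE /= !fsvalP lv (inj_eq val_inj) pq.
Qed.

(** Sort the pairs by the smaller of the two sides; each class gives distinct lines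
    counted by the corresponding summand of [Ele]. *)
Lemma Ele_lower (D : {set P * P}) (k : nat) :
    (forall p q, (p, q) \in D -> [/\ p != q, (q, p) \notin D &
       (minn (nleft X finset.setT p q) (nleft X finset.setT q p) <= k)%N]) ->
  (#|D| <= Ele P k)%N.
Proof.
move=> DP; pose h (u : P * P) := minn (nleft X finset.setT u.1 u.2) (nleft X finset.setT u.2 u.1).
rewrite -sum1_card (partition_big (fun u => inord (h u) : 'I_k.+1) predT) //=.
apply: leq_sum => j _; rewrite sum1dep_card; apply: E_lower => p q.
rewrite inE => /andP[pqD /eqP ej]; have [pq Nqp le_k] := DP _ _ pqD.
split => //; first by rewrite inE (negPf Nqp).
rewrite -ej inordK ?ltnS // leaves_nleft /h /=.
by case: (leqP (nleft X finset.setT p q)) => _; rewrite eqxx ?orbT.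
Qed.

Lemma Ele_ge_shallow (k : nat) : (2 * k + 3 <= #|` P|)%N ->
  (#|shallow X finset.setT k.+1| <= Ele P k)%N.
Proof.
move=> ltk; apply: Ele_lower => p q; rewrite !inE /= ltnS => /andP[pq le_k].
have := nleft_sum generic_val (A := finset.setT) (p := p) (q := q); rewrite !inE cardsT -cardfE.
move=> /(_ isT isT pq) esum; rewrite [q == p]eq_sym pq /= -ltnNge.
split => //; last by rewrite geq_min le_k.
by move: esum ltk le_k; clear; lia.
Qed.

(** With [n - 2 = 2 k] points off each line, its smaller side has at most [k] of
    them, so all lines are counted. *)
Lemma Ele_halving (k : nat) : (2 * k + 2 = #|` P|)%N -> ('C(#|` P|, 2) <= Ele P k)%N.
Proof.
move=> ek; pose D := [set u : P * P | (enum_rank u.1 < enum_rank u.2)%N].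
have cD : (2 * #|D| = #|` P| * #|` P|.-1)%N.
  pose D' := [set u : P * P | (u.2, u.1) \in D].
  have cD' : #|D'| = #|D| by exact: card_swap.
  rewrite mul2n -addnn -{2}cD' cardsU_disjoint; last first.
    by apply/setP => -[p q]; rewrite !inE /=; case: ltngtP.
  rewrite cardfE -cardsT -card_distinct_pairs; apply: eq_card => -[p q]; rewrite !inE /=.
  by rewrite -neq_ltn -(inj_eq enum_rank_inj).
have <- : #|D| = 'C(#|` P|, 2).
  by have := mul_bin_diag #|` P| 1; rewrite bin1; move: cD; clear; lia.
apply: Ele_lower => p q; rewrite !inE /= => lt_pq; rewrite -leqNgt (ltnW lt_pq).
have pq : p != q by apply: contraTneq lt_pq => ->; rewrite ltnn.
split => //.
have := nleft_sum generic_val (A := finset.setT) (p := p) (q := q); rewrite !inE cardsT -cardfE.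
by move=> /(_ isT isT pq); move: ek; clear; lia.
Qed.

End Link.

(** * Numerical estimates and conclusion *)

Section Numerics.
Variable R : realType.
Implicit Types x y w u : R.

Let bound x : R := 5 * x ^+ 2 + 19 * x - 31.

Lemma le_sqrt_of_sqr y v : y ^+ 2 <= v -> y <= Num.sqrt v.
Proof.
by move=> yv; apply: le_trans (ler_norm y) _; rewrite -sqrtr_sqr ler_wsqrtr.
Qed.

Lemma bound_ge x : 3 <= x -> 3 * (x + 2) * (x - 1) <= bound x /\ 71 <= bound x.
Proof. by move=> x3; rewrite /bound; split; nra. Qed.

(** Put [9 K = 4 n - 11 + r] and let [U] be the factor of 9 on the left.  The last
    hypothesis gives [27 U <= bound n + 9 - (5 n - 13) r - r ^ 2].  For [r = 0] the
    square root, slightly above [1 / 3], absorbs the 9; for [r >= 1] the right-hand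
    side is at most [bound n] and the square root is at least [1 / 3]. *)
Lemma base_estimate (n K S : nat) :
    (3 <= n)%N -> (4 * n <= 9 * K + 11)%N -> (9 * K + 3 <= 4 * n)%N ->
    (9 * K * K.+1 + (3 * K - n) * (3 * K - n + 3) <= 6 * S)%N ->
  9 * (n%:R * (n%:R - 1) / 2 - S%:R) <=
    bound n%:R * Num.sqrt ((n%:R - 2 * K%:R) / n%:R).
Proof.
move=> n3 lo hi leS.
set x : R := n%:R; set a : R := K%:R; set s : R := S%:R.
have x3 : 3 <= x by rewrite /x ler_nat.
have x0 : 0 < x by lra.
have [_ X71] := bound_ge x3.
have lo' : 4 * x <= 9 * a + 11 by rewrite /x /a -!natrM -natrD ler_nat.
have hi' : 9 * a + 3 <= 4 * x by rewrite /x /a -!natrM -natrD ler_nat.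
have hs : 9 * a * (a + 1) + (3 * a - x) * (3 * a - x + 3) <= 6 * s.
  have : ((9 * K * K.+1 + (3 * K - n) * (3 * K - n + 3))%N%:R : R) <= (6 * S)%N%:R by rewrite ler_nat.
  rewrite -(addn1 K) !(natrD, natrM) -/a -/s.
  have [le|lt] := leqP n (3 * K).
    by rewrite natrB // natrM -/a -/x.
  rewrite (eqP (ltnW lt : (_ - _ == 0)%N)) mul0r.
  have : 3 * a <= x by rewrite /x /a -natrM ler_nat ltnW.
  nra.
pose r : R := 9 * a - 4 * x + 11.
have ea : a = (r + 4 * x - 11) / 9 by rewrite /r; field.
have [r0|r1] : r = 0 \/ 9 <= (5 * x - 13) * r + r ^+ 2.
  have [e|ne] := eqVneq (9 * K + 11)%N (4 * n)%N.
    left; have : ((9 * K + 11)%N%:R : R) = (4 * n)%N%:R by rewrite e.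
    by rewrite natrD !natrM -/a -/x /r; lra.
  right; have : ((4 * n + 1)%N%:R : R) <= (9 * K + 11)%N%:R by rewrite ler_nat; lia.
  rewrite natrD (natrD _ (9 * K) 11) !natrM -/a -/x => r1.
  have [n5|n5] := leqP 5 n.
    have : 5 <= x by rewrite /x ler_nat.
    by rewrite /r; nra.
  have K1 : K = 1%N by lia.
  have ea1 : a = 1 by rewrite /a K1.
  have [e3|e4] : n = 3%N \/ n = 4%N by lia.
    have ex : x = 3 by rewrite /x e3.
    by rewrite /r ea1 ex; lra.
  have ex : x = 4 by rewrite /x e4.
  by rewrite /r ea1 ex; lra.
- have v : (x - 2 * a) / x = (x + 22) / (9 * x) by rewrite ea r0; field; lra.
  have le_u : 9 * (x * (x - 1) / 2 - s) <= (bound x + 9) / 3.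
    by rewrite ea r0 in hs; rewrite /bound; nra.
  apply: le_trans le_u _; rewrite v [leRHS]mulrC -ler_pdivrMr; last by lra.
  apply: le_sqrt_of_sqr; rewrite expr_div_n ler_pdivlMr; last by lra.
  rewrite mulrAC ler_pdivrMr; last by rewrite exprn_gt0 //; lra.
  have : (bound x + 9) ^+ 2 * x <= bound x ^+ 2 * (x + 22).
    have : 5 * x <= bound x by rewrite /bound; nra.
    by nra.
  nra.
have v : 1 / 9 <= (x - 2 * a) / x.
  rewrite ler_pdivlMr //; lra.
have le_u : 9 * (x * (x - 1) / 2 - s) <= bound x / 3.
  by rewrite ea in hs; rewrite /bound; nra.
apply: le_trans le_u _; rewrite ler_pM2l; last by lra.
by apply: le_sqrt_of_sqr; lra.
Qed.

(** In the first case [u'] is at most [(w - 1) / w] times [u], and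
    [(w - 1) ^ 2 * (w + 2) <= w ^ 3].  In the second case use [9 w <= x + 4]. *)
Lemma step_estimate x w u u' :
    3 <= x -> 1 <= w -> 9 * w <= x + 4 ->
    9 * u <= bound x * Num.sqrt ((w + 2) / x) ->
    u' <= (w - 1) * (u - u') \/ u' <= (w - 1) * (x - 1) ->
  9 * u' <= bound x * Num.sqrt (w / x).
Proof.
move=> x3 w1 w9 le_u; have [X1 X71] := bound_ge x3.
have X0 : 0 < bound x by lra.
have x0 : 0 < x by lra.
case=> le_u'.
  have {}le_u' : 9 * u' <= bound x * ((w - 1) / w * Num.sqrt ((w + 2) / x)).
    have h : 9 * u' <= (w - 1) / w * (9 * u).
      by rewrite mulrAC ler_pdivlMr; [nra | lra].
    apply: le_trans h _; rewrite [leRHS]mulrCA ler_wpM2l //.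
    by rewrite divr_ge0 //; lra.
  apply: le_trans le_u' _; rewrite ler_pM2l //; apply: le_sqrt_of_sqr.
  rewrite exprMn sqr_sqrtr; last by rewrite divr_ge0 //; lra.
  rewrite mulrA ler_pM2r ?invr_gt0 // expr_div_n mulrAC ler_pdivrMr; last by nra.
  by nra.
have -> : 9 * u' = bound x * (9 * u' / bound x) by field; lra.
rewrite ler_pM2l //.
apply: (@le_trans _ _ (9 * ((w - 1) * (x - 1)) / bound x)).
  by rewrite ler_pM2r ?invr_gt0 //; lra.
apply: le_sqrt_of_sqr.
rewrite expr_div_n ler_pdivrMr ?exprn_gt0 // mulrAC ler_pdivlMr //.
have h1 : (9 * ((w - 1) * (x - 1))) ^+ 2 * x <= w * (9 * (x + 4) * x * (x - 1) ^+ 2).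
  have -> : (9 * ((w - 1) * (x - 1))) ^+ 2 * x = 81 * (w - 1) ^+ 2 * (x * (x - 1) ^+ 2) by ring.
  have -> : w * (9 * (x + 4) * x * (x - 1) ^+ 2) = (9 * w * (x + 4)) * (x * (x - 1) ^+ 2) by ring.
  apply: ler_wpM2r; first by rewrite mulr_ge0 ?sqr_ge0 // ltW.
  by nra.
apply: le_trans h1 _; rewrite ler_wpM2l //; first by lra.
have : (3 * (x + 2) * (x - 1)) ^+ 2 <= bound x ^+ 2.
  by rewrite ler_pXn2r // ?nnegrE; nra.
apply: le_trans.
have -> : (3 * (x + 2) * (x - 1)) ^+ 2 = (9 * (x + 2) ^+ 2) * (x - 1) ^+ 2 by ring.
by apply: ler_wpM2r; [exact: sqr_ge0 | nra].
Qed.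
End Numerics.

Section Growth.
Variables (R : realType) (T : finType) (X : T -> R * R).
Hypotheses (Xgp : generic X) (Xinj : injective X).
Let n := #|T|.
Let S j : R := #|shallow X finset.setT j|%:R.

Lemma shallow_estimate K j : (3 <= n)%N -> (4 * n <= 9 * K + 11)%N -> (9 * K + 3 <= 4 * n)%N ->
    (K <= j)%N -> (2 * j < n)%N ->
  9 * (n%:R * (n%:R - 1) / 2 - S j) <=
    (5 * n%:R ^+ 2 + 19 * n%:R - 31) * Num.sqrt ((n%:R - 2 * j%:R) / n%:R).
Proof.
move=> n3 lo hi leKj; rewrite -(subnKC leKj); elim: (j - K)%N => [|d IH] {leKj j}.
  rewrite addn0 => lt_n; apply: base_estimate => //.
  by have := shallow_bound Xgp Xinj (K := K) (A := finset.setT); rewrite cardsT; apply.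
rewrite addnS; move: (K + d)%N (leq_addr d K) IH => j leKj IH lt_n.
have small : (2 * j + 3 <= n)%N by move: lt_n; clear; lia.
have lt_j : (2 * j < n)%N by move: small; clear; lia.
have {}IH := IH lt_j.
have eqD := card_deep Xgp small; have eqL := card_level X j.
have leD := deep_bound Xgp Xinj small; rewrite -/n in eqD leD.
have x3 : 3 <= n%:R :> R by rewrite ler_nat.
have lo' : 4 * n%:R <= 9 * K%:R + 11 :> R by rewrite -!natrM -natrD ler_nat.
have leKj' : K%:R <= j%:R :> R by rewrite ler_nat.
have small' : 2 * j%:R + 3 <= n%:R :> R by rewrite -natrM -natrD ler_nat.
have eqD' : #|deep X j|%:R + 2 * S j.+1 = n%:R * (n%:R - 1).
  rewrite /S -natrM -natrD eqD natrM; congr (_ * _).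
  by rewrite -subn1 natrB //; move: n3; clear; lia.
have eqL' : #|level X j|%:R + S j = S j.+1 by rewrite /S -natrD eqL.
have eqw : (n - 2 * j - 3)%:R = n%:R - 2 * j%:R - 3 :> R.
  by rewrite -subnDA natrB // natrD natrM opprD addrA.
rewrite -[j.+1%:R]natr1.
apply: (@step_estimate _ n%:R (n%:R - 2 * (j%:R + 1)) (n%:R * (n%:R - 1) / 2 - S j)) => //; try lra.
  by congr (_ <= _ * Num.sqrt (_ / _)): IH; ring.
have e1 : n%:R - 2 * (j%:R + 1) - 1 = n%:R - 2 * j%:R - 3 :> R by ring.
have en : n.-1%:R = n%:R - 1 :> R by rewrite -subn1 natrB //; move: n3; clear; lia.
have u'E : n%:R * (n%:R - 1) / 2 - S j.+1 = #|deep X j|%:R / 2 by lra.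
have -> : n%:R * (n%:R - 1) / 2 - S j - (n%:R * (n%:R - 1) / 2 - S j.+1) = #|level X j|%:R by lra.
rewrite u'E e1 -eqw -en -!natrM.
have : (#|deep X j|%:R : R) <= (2 * (n - 2 * j - 3) * maxn #|level X j| n.-1)%:R by rewrite ler_nat.
by rewrite /maxn; case: ifP => _; rewrite -mulnA natrM => le_d; [right | left]; lra.
Qed.
End Growth.

Unset Implicit Arguments.

Theorem corollary3 (R : realType) (n : nat) (hn : (0 < n)%N)
    (m : int) (hm : m = Num.ceil ((4 * n%:R - 11) / 9 : R))
    (k : nat) (hmk : m - 1 <= k%:Z) (hkn : k%:R <= (n%:R - 2) / 2 :> R) :
  (Ele_min R n k)%:R >=
    ('C(n, 2))%:R
    - 1 / 9 * Num.sqrt (1 - (2 * k%:R + 2) / n%:R)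
      * (5 * n%:R ^+ 2 + 19 * n%:R - 31) :> R.
Proof.
rewrite /Ele_min; case: ex_minnP => v /asboolP[P [cP Pgp <-]] _.
have le_n : (2 * k + 2 <= n)%N.
  have : ((2 * k + 2)%:R : R) <= n%:R by rewrite natrD natrM; lra.
  by rewrite ler_nat.
have [eq_n|ne_n] := eqVneq (2 * k + 2)%N n.
  have -> : 1 - (2 * k%:R + 2) / n%:R = 0 :> R.
    by rewrite -eq_n natrD natrM; field; rewrite -natrM -natrD pnatr_eq0 addnS.
  rewrite sqrtr0 mulr0 mul0r subr0 ler_nat -cP; apply: Ele_halving => //.
  by rewrite cP.
have lt_n : (2 * k + 3 <= n)%N by lia.
have n3 : (3 <= n)%N by lia.
have x3 : 3 <= n%:R :> R by rewrite ler_nat.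
have := ceil_itv ((4 * n%:R - 11) / 9 : R); rewrite -hm => /andP[].
have m_gt0 : 0 < m by rewrite hm ceil_gt0; lra.
case: m m_gt0 hmk {hm} => // -[//|K] _ hmk.
rewrite intrD /= => hi lo.
have hi' : (9 * K.+1 + 3 <= 4 * n)%N.
  have : ((9 * K.+1 + 2)%:R : R) < (4 * n)%:R by rewrite natrD !natrM; lra.
  by rewrite ltr_nat; lia.
have lo' : (4 * n <= 9 * K.+1 + 11)%N.
  have : ((4 * n)%:R : R) <= (9 * K.+1 + 11)%:R by rewrite natrD !natrM; lra.
  by rewrite ler_nat.
have leKk : (K.+1 <= k.+1)%N by lia.
have := @Ele_ge_shallow R P Pgp k; rewrite cP => /(_ lt_n).
have := @shallow_estimate R P (fun p : P => val p) (generic_val Pgp) val_inj K.+1 k.+1.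
rewrite -cardfE cP => /(_ n3 lo' hi' leKk); rewrite -[k.+1%:R]natr1 => est leE.
have {}est := est ltac:(lia).
have -> : 1 - (2 * k%:R + 2) / n%:R = (n%:R - 2 * (k%:R + 1)) / n%:R :> R.
  by field; lra.
have -> : 'C(n, 2)%:R = n%:R * (n%:R - 1) / 2 :> R.
  have : ((2 * 'C(n, 2))%:R : R) = (n * n.-1)%:R by rewrite -mul_bin_diag bin1.
  rewrite !natrM -subn1 natrB //; lra.
have := leE; rewrite -(ler_nat R); lra.
Qed.
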